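(* Let $s\ge 2$. The subfamily $\mathcal{RI}\Omega^1(-s)$ of isochronous 1-forms is a $(3s-1)$-dimensional real analytic submanifold of $\Omega^1(-1^s)$.
   Context: $\Omega^1(-1^s)$ denotes the set of rational 1-forms on the Riemann sphere $\widehat{\mathbb C}$ having exactly $s$ poles, all simple (zeros are arbitrary). It is a $(2s-1)$-dimensional complex manifold via the bijection sending $\omega$ to the class $\langle r_1,\dots,r_s;p_1,\dots,p_s\rangle$ of its residues $r_\iota$ at its poles $p_\iota$ in $$\frac{H_s\times(\widehat{\mathbb C}^s\setminus\Delta)}{\mathcal S(s)},$$ where $H_s=\{(r_1,\dots,r_s)\in(\mathbb C^* )^s : \sum r_\iota=0\}$, $\widehat{\mathbb C}^s\setminus\Delta$ is the set of $s$-tuples of pairwise distinct points of $\widehat{\mathbb C}$, and the symmetric group $\mathcal S(s)$ acts by simultaneous permutation of the $r_\iota$ and the $p_\iota$ (a free, properly discontinuous action). A form $\omega\in\Omega^1(-1^s)$ is isochronous if all its residues are purely imaginary, and $\mathcal{RI}\Omega^1(-s)=\{\omega\in\Omega^1(-1^s):\omega\text{ is isochronous}\}$. Dimension of $\mathcal{RI}\Omega^1(-s)$ means real dimension. *)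

(* Defs.v *)
From HB Require Import structures.
From mathcomp Require Import all_boot all_order all_algebra.
From mathcomp Require Import all_classical all_reals all_analysis.
From mathcomp Require Import generic_quotient fraction perm complex.
Set Implicit Arguments.
Unset Strict Implicit.
Unset Printing Implicit Defensive.
Import Order.TTheory GRing.Theory Num.Theory.
Import numFieldNormedType.Exports.
Local Open Scope classical_set_scope.
Local Open Scope ring_scope.
Local Open Scope complex_scope.

Section RealAnalytic.
Variable R : realType.

(* The multi-indexed series is summed over the cubes {0, ..., N-1}^m; requiring
   its absolute partial sums to converge as well makes it absolutely convergent,
   so that the order of summation is immaterial. *)
Definition power_series_term (m : nat) (c : ('I_m -> nat) -> R)
    (h : 'rV[R]_m) (a : 'I_m -> nat) : R :=
  c a * \prod_(i < m) h 0 i ^+ a i.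

Definition real_analytic_at (m : nat) (f : 'rV[R]_m -> R) (x : 'rV[R]_m) :=
  exists (c : ('I_m -> nat) -> R) (e : R), 0 < e /\
  forall h : 'rV[R]_m, (forall i, `|h 0 i| < e) ->
    cvgn (fun N : nat => \sum_(a : {ffun 'I_m -> 'I_N})
            `|power_series_term c h (fun i => a i : nat)|) /\
    (fun N : nat => \sum_(a : {ffun 'I_m -> 'I_N})
            power_series_term c h (fun i => a i : nat)) @ \oo --> f (x + h).

Definition real_analytic_on (m k : nat) (D : set 'rV[R]_m)
    (f : 'rV[R]_m -> 'rV[R]_k) :=
  forall x, D x -> forall j, real_analytic_at (fun y => f y 0 j) x.

End RealAnalytic.

Section Manifolds.
Variable R : realType.
Local Notation C := R[i].

(* A chart with values in E of (a subset of) the type T; [chart_map] is only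
   meaningful on [chart_dom]. *)
Record chart (T E : Type) := Chart { chart_dom : set T; chart_map : T -> E }.

(* C^n is identified with R^(2n), real parts first. *)
Definition realify (n : nat) (v : 'rV[C]_n) : 'rV[R]_(n + n) :=
  row_mx (map_mx (@complex.Re R) v) (map_mx (@complex.Im R) v).

Definition realify_chart (T : Type) (n : nat) (phi : chart T 'rV[C]_n) :
    chart T 'rV[R]_(n + n) :=
  Chart (chart_dom phi) (fun x => realify (chart_map phi x)).

Definition analytic_transition (T : Type) (m : nat)
    (phi psi : chart T 'rV[R]_m) :=
  let D := chart_dom phi `&` chart_dom psi in
  open (chart_map phi @` D) /\
  exists2 g : 'rV[R]_m -> 'rV[R]_m,
    {in D, forall x, g (chart_map phi x) = chart_map psi x} &
    real_analytic_on (chart_map phi @` D) g.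

Definition analytically_compatible (T : Type) (m : nat)
    (phi psi : chart T 'rV[R]_m) :=
  analytic_transition phi psi /\ analytic_transition psi phi.

(* A complex manifold is presented by its set of points M and a holomorphic
   atlas A; its topology is the one given by the charts. The following are the
   charts of the underlying real analytic manifold, that is the members of the
   maximal real analytic atlas. *)
Definition real_analytic_chart (T : Type) (n : nat) (M : set T)
    (A : set (chart T 'rV[C]_n)) (psi : chart T 'rV[R]_(n + n)) :=
  [/\ chart_dom psi `<=` M,
      set_inj (chart_dom psi) (chart_map psi),
      open (chart_map psi @` chart_dom psi) &
      forall phi, A phi -> analytically_compatible (realify_chart phi) psi].

Definition real_analytic_submanifold (T : Type) (n : nat) (M : set T)
    (A : set (chart T 'rV[C]_n)) (d : nat) (N : set T) :=
  [/\ (d <= n + n)%N, N `<=` M &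
      forall x, N x -> exists psi : chart T 'rV[R]_(n + n),
        [/\ real_analytic_chart M A psi, chart_dom psi x &
            chart_map psi @` (chart_dom psi `&` N) =
            chart_map psi @` chart_dom psi `&`
              [set y | forall j : 'I_(n + n), (d <= j)%N -> y 0 j = 0]]].

(* The charts of the quotient proj : X -> Q of a manifold with charts A, by a
   free and properly discontinuous action: the charts phi \o (proj|_V)^-1, for V
   an open subset of the domain of phi on which proj is injective. *)
Definition quotient_chart (X Q : Type) (n : nat) (proj : X -> Q) (V : set X)
    (phi : chart X 'rV[C]_n) : chart Q 'rV[C]_n :=
  Chart (proj @` V) (fun q => xget 0 (chart_map phi @` (V `&` proj @^-1` [set q]))).

Definition quotient_atlas (X Q : Type) (n : nat) (proj : X -> Q)
    (A : set (chart X 'rV[C]_n)) : set (chart Q 'rV[C]_n) :=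
  [set psi | exists (phi : chart X 'rV[C]_n) (V : set X),
     [/\ A phi, V `<=` chart_dom phi,
         open ((fun x => realify (chart_map phi x)) @` V), set_inj V proj &
         psi = quotient_chart proj V phi]].

(* Transport of the charts of Q along a map f that is bijective from M to Q. *)
Definition pullback_chart (T Q : Type) (n : nat) (M : set T) (f : T -> Q)
    (phi : chart Q 'rV[C]_n) : chart T 'rV[C]_n :=
  Chart (M `&` f @^-1` chart_dom phi) (chart_map phi \o f).

Definition pullback_atlas (T Q : Type) (n : nat) (M : set T) (f : T -> Q)
    (A : set (chart Q 'rV[C]_n)) : set (chart T 'rV[C]_n) :=
  pullback_chart M f @` A.

End Manifolds.

Section OneForms.
Variable R : realType.
Local Notation C := R[i].

(* The Riemann sphere; None is the point at infinity. *)
Definition sphere : Type := option C.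

Definition ratfun : Type := {fraction {poly C}}.

Definition poly_at (p : {poly C}) (u : ratfun) : ratfun :=
  (map_poly (fun c : C => tofrac c%:P : ratfun) p).[u].

(* f \o u, for a non-constant rational function u. *)
Definition ratfun_comp (f u : ratfun) : ratfun :=
  let nd := frac (generic_quotient.repr f) in poly_at nd.1 u / poly_at nd.2 u.

(* A rational function f : ratfun also stands for the rational 1-form f(z) dz.
   [local_form f p] is the function g such that this form is g(w) dw in the
   local coordinate w centred at p, where z = w + p if p is finite, and
   z = 1/w, dz = - dw / w^2 if p is infinity. *)
Definition local_form (f : ratfun) (p : sphere) : ratfun :=
  let w : ratfun := tofrac 'X in
  match p with
  | Some a => ratfun_comp f (tofrac ('X + a%:P))
  | None => - (ratfun_comp f w^-1 / w ^+ 2)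
  end.

(* q(1/w), where q has no constant term, is the principal part at w = 0 of the
   Laurent expansion of g. *)
Definition is_principal_part (g : ratfun) (q : {poly C}) :=
  q`_0 = 0 /\
  exists n d : {poly C}, d.[0] != 0 /\
    g = poly_at q (tofrac 'X)^-1 + tofrac n / tofrac d.

Definition principal_part (f : ratfun) (p : sphere) : {poly C} :=
  xget 0 (is_principal_part (local_form f p)).

(* 0 when p is not a pole. *)
Definition pole_order (f : ratfun) (p : sphere) : nat :=
  (size (principal_part f p)).-1.

Definition residue (f : ratfun) (p : sphere) : C := (principal_part f p)`_1.

Definition poles (f : ratfun) : set sphere :=
  [set p | (0 < pole_order f p)%N].

(* The forms with exactly s poles, all simple. *)
Definition Omega (s : nat) : set ratfun :=
  [set f | (poles f #= `I_s)%card /\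
           forall p, poles f p -> pole_order f p = 1%N].

Definition isochronous (f : ratfun) :=
  forall p, poles f p -> complex.Re (residue f p) = 0.

Definition RIOmega (s : nat) : set ratfun := Omega s `&` isochronous.

Definition sphere_chart (at_infinity : bool) : chart sphere C :=
  if at_infinity then
    Chart [set p | p <> Some 0] (fun p => if p is Some z then z^-1 else 0)
  else
    Chart [set p | p <> None] (fun p => if p is Some z then z else 0).

Definition config (s : nat) : Type := (('I_s -> C) * ('I_s -> sphere))%type.

(* H_s x (sphere^s \ Delta) *)
Definition configs (s : nat) : set (config s) :=
  [set x : config s | [/\ forall i, x.1 i != 0, \sum_i x.1 i = 0 & injective x.2]].

(* H_s is parametrized by its first s - 1 coordinates, so that the dimension is
   (s - 1) + s; b selects a chart of the sphere for each pole. *)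
Definition config_chart (s : nat) (b : 'I_s -> bool) :
    chart (config s) 'rV[C]_(s.-1 + s) :=
  Chart (@configs s `&` [set x : config s | forall i, chart_dom (sphere_chart (b i)) (x.2 i)])
    (fun x => row_mx (\row_(i < s.-1) x.1 (widen_ord (leq_pred s) i))
                     (\row_(i < s) chart_map (sphere_chart (b i)) (x.2 i))).

Definition config_atlas (s : nat) : set (chart (config s) 'rV[C]_(s.-1 + s)) :=
  range (@config_chart s).

(* The S(s)-orbit of a configuration; points of the quotient are orbits. *)
Definition config_class (s : nat) (x : config s) : set (config s) :=
  [set y : config s | exists sigma : 'S_s, y = (x.1 \o sigma, x.2 \o sigma)].

(* The class <r_1, ..., r_s; p_1, ..., p_s> of the residues of a form at its
   poles: all the ways of numbering the poles. *)
Definition residue_class (s : nat) (f : ratfun) : set (config s) :=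
  [set x : config s | [/\ injective x.2, range x.2 = poles f &
              forall i, x.1 i = residue f (x.2 i)]].

(* The complex manifold structure of Omega s. *)
Definition Omega_atlas (s : nat) : set (chart ratfun 'rV[C]_(s.-1 + s)) :=
  pullback_atlas (Omega s) (@residue_class s)
    (quotient_atlas (@config_class s) (@config_atlas s)).

End OneForms.

Arguments Omega R s : clear implicits.
Arguments RIOmega R s : clear implicits.
Arguments Omega_atlas R s : clear implicits.

(* Main.v *)
Require Import Defs.
From mathcomp Require Import all_boot all_order all_algebra.
From mathcomp Require Import all_classical all_reals all_analysis.
From mathcomp Require Import generic_quotient fraction perm complex.
From mathcomp Require Import ring zify.
Set Implicit Arguments.
Unset Strict Implicit.
Unset Printing Implicit Defensive.
Import Order.TTheory GRing.Theory Num.Theory.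
Import numFieldNormedType.Exports.
Local Open Scope classical_set_scope.
Local Open Scope ring_scope.
Local Open Scope complex_scope.

(** Forms with [s] simple poles are parametrized by their residues and poles, and
    in these coordinates the isochronous forms are cut out by linear equations.
    Indeed, a form is the sum of the simple fractions [r_i dz / (z - p_i)] over
    its finite poles ([partial_fractions]: the difference has no pole, and there
    is no nonzero holomorphic form on the sphere), and the same argument at
    infinity shows that the residues add up to 0. Conversely every configuration
    of [s] nonzero residues of sum 0 at distinct points comes from such a sum.
    Hence numbered configurations, up to renumbering, are the same thing as
    forms ([Omega_form_of], [residue_class_form_of]).

    The coordinates on configurations are [s - 1] of the residues and the [s]
    poles, so that there are [4s - 2] real coordinates. A form is isochronous if
    and only if the real parts of these [s - 1] residues vanish, the last residue
    being minus their sum; this leaves [3s - 1] coordinates. The adapted chart at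
    a form is thus the usual one with these real parts moved to the end
    ([cell_chart], [coords_last]); it is defined where the poles stay in disjoint
    neighbourhoods of those of the given form, so that they can be numbered
    without ambiguity.

    It remains to check that this chart is compatible with every chart of the
    atlas. Locally a transition map renumbers the poles by a fixed permutation
    and changes the coordinate at some poles from [z] to [1/z]
    ([residue_chart_transition]). Besides linear maps, one thus needs the real
    and imaginary parts of [1/z] to be real analytic in the strong sense of
    absolutely convergent expansions in two variables. This comes from the
    expansion of [1 / (1 - a - b)] with binomial coefficients, whose sums over
    squares are computed by Pascal's rule ([square_sum_pascal],
    [inverse_series]). *)

(** * Polar parts and partial fractions *)
Section PrincipalParts.
Variables (K : closedFieldType) (F : fieldType).
Variable iota : {rmorphism {poly K} -> F}.
Hypothesis iota_inj : injective iota.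
Implicit Types (f g u : F) (p q n d : {poly K}).

Local Notation w := (iota 'X).

Definition eval_at p u := (map_poly (iota \o polyC) p).[u].

(** The lemmas on rational functions are stated for an abstract field [F] of
    fractions of [{poly K}], in which [compose f u] stands for [f \o u]. All
    they need of [compose] is a way of computing it on some fraction equal to
    [f]. The letter [w] is the local coordinate of a Laurent expansion. *)
Variable compose : F -> F -> F.
Hypothesis composeP : forall f u, exists n d,
  [/\ d != 0, f = iota n / iota d & compose f u = eval_at n u / eval_at d u].

(** The form [f(z) dz] in the coordinate centred at a point of the sphere; at
    infinity [z = 1/w] and [dz = - dw / w^2]. *)
Definition local_expansion f (P : option K) :=
  if P is Some a then compose f (iota ('X + a%:P))
  else - (compose f w^-1 / w ^+ 2).

(** [q(1/w)] is the polar part at [w = 0] of the Laurent expansion of [g]. *)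
Definition is_polar_part g q := q`_0 = 0 /\
  exists n d, d.[0] != 0 /\ g = eval_at q w^-1 + iota n / iota d.

Let iota_eq p q : (iota p == iota q) = (p == q).
Proof. exact: inj_eq. Qed.

Let iota_eq0 p : (iota p == 0) = (p == 0).
Proof. by rewrite -(rmorph0 iota) iota_eq. Qed.

Lemma fractionP f : exists n d, d != 0 /\ f = iota n / iota d.
Proof. by have [n [d [d0 -> _]]] := composeP f 0; exists n, d. Qed.

Lemma eval_atE p u : eval_at p u = (map_poly (iota \o polyC) p).[u].
Proof. by []. Qed.

Lemma eval_atD p q u : eval_at (p + q) u = eval_at p u + eval_at q u.
Proof. by rewrite !eval_atE rmorphD hornerD. Qed.

Lemma eval_atB p q u : eval_at (p - q) u = eval_at p u - eval_at q u.
Proof. by rewrite !eval_atE rmorphB hornerD hornerN. Qed.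

Lemma eval_atM p q u : eval_at (p * q) u = eval_at p u * eval_at q u.
Proof. by rewrite !eval_atE rmorphM hornerM. Qed.

Lemma eval_atC (c : K) u : eval_at c%:P u = iota c%:P.
Proof. by rewrite eval_atE map_polyC hornerC. Qed.

Lemma eval_atX u : eval_at 'X u = u.
Proof. by rewrite eval_atE map_polyX hornerX. Qed.

Lemma eval_at0 u : eval_at 0 u = 0.
Proof. by rewrite eval_atE rmorph0 horner0. Qed.

Lemma eval_atZ (c : K) p u : eval_at (c *: p) u = iota c%:P * eval_at p u.
Proof. by rewrite -mul_polyC eval_atM eval_atC. Qed.

Lemma eval_at_iota p q : eval_at p (iota q) = iota (p \Po q).
Proof.
elim/poly_ind: p => [|p c IH]; first by rewrite eval_at0 comp_poly0 rmorph0.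
rewrite eval_atD eval_atM eval_atX eval_atC IH comp_poly_MXaddC.
by rewrite rmorphD rmorphM.
Qed.

Lemma w_neq0 : w != 0.
Proof. by rewrite iota_eq0 polyX_eq0. Qed.

(** Putting [p(1/w)] over the denominator [w^deg p] reverses the coefficients
    of [p], so that the numerator does not vanish at the origin. *)
Lemma eval_at_invX p : exists2 q : {poly K}, q.[0] = lead_coef p &
  eval_at p w^-1 = iota q / w ^+ (size p).-1.
Proof.
elim/poly_ind: p => [|p c [q q0 IH]].
  by exists 0; rewrite ?horner0 ?lead_coef0 // eval_at0 rmorph0 mul0r.
have [->|p0] := eqVneq p 0.
  exists c%:P; first by rewrite mul0r add0r lead_coefC hornerC.
  rewrite mul0r add0r eval_atC size_polyC.
  by case: (c != 0); rewrite expr0 divr1.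
exists (q + c%:P * 'X^(size p)).
  rewrite hornerD hornerM hornerXn expr0n size_poly_eq0 (negPf p0) mulr0.
  rewrite addr0 q0 lead_coefDl ?lead_coefMX // size_mulX // size_polyC.
  by case: (c != 0); rewrite ltnS ?lt0n ?size_poly_eq0.
rewrite eval_atD eval_atM eval_atX eval_atC IH size_MXaddC (negPf p0) /=.
have w0 := w_neq0.
have -> : size p = (size p).-1.+1 by rewrite prednK // lt0n size_poly_eq0.
have wk : w ^+ (size p).-1.+1 != 0 by rewrite expf_eq0 (negPf w0) andbF.
rewrite rmorphD rmorphM rmorphXn /= mulrDl (mulfK wk); congr (_ + _).
by rewrite exprSr invfM mulrA mulrAC.
Qed.

Definition regular0 g :=
  exists n d : {poly K}, d.[0] != 0 /\ g = iota n / iota d.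

Lemma den_neq0 d : d.[0] != 0 -> iota d != 0 :> F.
Proof.
by move=> d0; rewrite iota_eq0; apply: contraNneq d0 => ->; rewrite horner0.
Qed.

Lemma regular0_poly n : regular0 (iota n).
Proof. by exists n, 1; rewrite hornerC oner_neq0 rmorph1 divr1. Qed.

Lemma regular0D f g : regular0 f -> regular0 g -> regular0 (f + g).
Proof.
move=> [n [d [d0 ->]]] [n' [d' [d'0 ->]]].
exists (n * d' + n' * d), (d * d'); split; first by rewrite hornerM mulf_neq0.
by rewrite rmorphD !rmorphM /= addf_div // ?den_neq0.
Qed.

Lemma regular0N f : regular0 f -> regular0 (- f).
Proof. by move=> [n [d [d0 ->]]]; exists (- n), d; rewrite rmorphN mulNr. Qed.

Lemma regular0B f g : regular0 f -> regular0 g -> regular0 (f - g).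
Proof. by move=> rf rg; apply/regular0D/regular0N. Qed.

(** A nonconstant polynomial in [1/w] does have a pole at the origin: clear the
    denominators with [eval_at_invX] and evaluate at 0. This is what makes polar
    parts unique. *)
Lemma regular0_eval_at_invX p : regular0 (eval_at p w^-1) -> (size p <= 1)%N.
Proof.
move=> [n [d [d0 E]]]; rewrite leqNgt; apply/negP => sp.
have [q q0 Eq] := eval_at_invX p; rewrite Eq in E.
have : q * d = n * 'X^((size p).-1).
  apply/eqP; rewrite -(iota_eq (q * d)) !rmorphM /= rmorphXn /=.
  by rewrite -eqr_div ?den_neq0 ?expf_neq0 ?w_neq0 // E.
move/(congr1 (fun r => r.[0])); rewrite !hornerM hornerXn q0.
have -> : 0 ^+ (size p).-1 = 0 :> K.
  by case: (size p) sp => [|[|k]] // _; rewrite expr0n.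
rewrite mulr0 => /eqP; rewrite mulf_eq0 (negPf d0) orbF lead_coef_eq0.
move=> /eqP p0.
by move: sp; rewrite p0 size_poly0.
Qed.

Lemma polar_partP g q :
  is_polar_part g q <-> q`_0 = 0 /\ regular0 (g - eval_at q w^-1).
Proof.
split=> [[q0 [n [d [d0 ->]]]]|[q0 [n [d [d0 E]]]]]; split => //; exists n, d.
  by rewrite addrC addKr.
by rewrite -E addrC subrK.
Qed.

Lemma polar_part_unique g q q' :
  is_polar_part g q -> is_polar_part g q' -> q = q'.
Proof.
move=> /polar_partP[q0 rq] /polar_partP[q'0 rq'].
have := regular0B rq' rq.
rewrite opprB addrC addrA subrK -eval_atB => /regular0_eval_at_invX/size1_polyC.
by rewrite coefB q0 q'0 subr0 => /eqP; rewrite subr_eq0 => /eqP.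
Qed.

Lemma is_polar_partD g h q r : is_polar_part g q ->
  is_polar_part h r -> is_polar_part (g + h) (q + r).
Proof.
move=> /polar_partP[q0 rq] /polar_partP[r0 rr]; apply/polar_partP.
split; first by rewrite coefD q0 r0 addr0.
by rewrite eval_atD opprD addrACA; apply: regular0D.
Qed.

Lemma is_polar_part0 : is_polar_part (0 : F) 0.
Proof.
apply/polar_partP; rewrite coef0 eval_at0 subr0; split => //.
by rewrite -(rmorph0 iota); exact: regular0_poly.
Qed.

Lemma is_polar_partN g q : is_polar_part g q ->
  is_polar_part (- g) (- q).
Proof.
move=> /polar_partP[q0 rq]; apply/polar_partP.
rewrite coefN q0 oppr0; split => //.
have -> : eval_at (- q) w^-1 = - eval_at q w^-1.
  by rewrite -[- q]sub0r eval_atB eval_at0 sub0r.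
by rewrite -opprD; apply: regular0N.
Qed.

Lemma is_polar_part_sum (I : finType) (g : I -> F) (q : I -> {poly K}) :
  (forall i, is_polar_part (g i) (q i)) ->
  is_polar_part (\sum_i g i) (\sum_i q i).
Proof.
move=> H; elim/big_ind2: _ => //; first exact: is_polar_part0.
by move=> *; apply: is_polar_partD.
Qed.

(** Write [g = n / (w^k d)] with [d(0) != 0] and induct on [k]: subtracting
    [c / w^k] for [c = n(0) / d(0)] makes the numerator divisible by [w]. *)
Lemma polar_part_exists g : exists q, is_polar_part g q.
Proof.
have [n [d [d0 ->]]] := fractionP g.
have [k [d' d'0 ->]] := multiplicity_XsubC d 0.
rewrite d0 /= /root in d'0; move: n => n {d d0}.
rewrite subr0; elim: k n => [|k IH] n.
  exists 0; apply/polar_partP; rewrite coef0 eval_at0 subr0; split=> //.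
  by exists n, d'; rewrite expr0 mulr1.
have [c Ec] : exists c, n.[0] = c * d'.[0].
  by exists (n.[0] / d'.[0]); rewrite divfK.
have : root (n - c *: d') 0 by rewrite /root hornerD hornerN hornerZ Ec subrr.
move/factor_theorem => [n1]; rewrite subr0 => En1.
have [q /polar_partP[q0 rq]] := IH n1.
exists (q + c *: 'X^(k.+1)); apply/polar_partP.
split; first by rewrite coefD q0 coefZ coefXn mulr0 addr0.
rewrite eval_atD; have {q0} := rq; congr regular0; rewrite opprD addrA addrAC.
congr (_ - _).
have -> : n = n1 * 'X + c *: d' by rewrite -En1 subrK.
have -> : eval_at (c *: 'X^(k.+1)) w^-1 = iota c%:P / w ^+ k.+1.
  by rewrite eval_atZ eval_atE map_polyXn hornerXn exprVn.
have d'0' := den_neq0 d'0; have w0 := w_neq0.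
rewrite -mul_polyC !rmorphD !rmorphM /= !rmorphXn /= !exprSr.
have wk : w ^+ k != 0 by rewrite expf_neq0.
field.
by rewrite w0 wk d'0'.
Qed.

(** Transcendence over [K], which for rational functions amounts to not being
    constant; [f \o u] is then a field morphism in [f]. *)
Definition nonconstant u := forall p, p != 0 -> eval_at p u != 0.

Lemma composeE n d u : nonconstant u -> d != 0 ->
  compose (iota n / iota d) u = eval_at n u / eval_at d u.
Proof.
move=> hu d0; have [n' [d' [d'0 /eqP E ->]]] := composeP (iota n / iota d) u.
move: E.
rewrite eqr_div ?iota_eq0 // -!rmorphM /= iota_eq => /eqP E.
by apply/eqP; rewrite eqr_div ?hu // -!eval_atM E.
Qed.

Lemma composeD f g u : nonconstant u ->
  compose (f + g) u = compose f u + compose g u.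
Proof.
move=> hu; have [n [d [d0 ->]]] := fractionP f.
have [n' [d' [d'0 ->]]] := fractionP g.
rewrite addf_div ?iota_eq0 // -!rmorphM -rmorphD /= !composeE ?mulf_neq0 //.
by rewrite eval_atD !eval_atM addf_div ?hu.
Qed.

Lemma compose_poly p u : nonconstant u ->
  compose (iota p) u = eval_at p u.
Proof.
move=> hu; rewrite -[iota p]divr1 -(rmorph1 iota) composeE ?oner_neq0 //.
by rewrite eval_atC rmorph1 divr1.
Qed.

Lemma nonconstant_shift (a : K) : nonconstant (iota ('X + a%:P)).
Proof.
move=> p p0; rewrite eval_at_iota iota_eq0 comp_poly_eq0 //.
by rewrite size_XaddC.
Qed.

Lemma nonconstant_invX : nonconstant w^-1.
Proof.
move=> p p0; have [q q0 ->] := eval_at_invX p.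
have w0 := w_neq0; apply: mulf_neq0; last first.
  by rewrite invr_eq0 expf_eq0 (negPf w0) andbF.
rewrite iota_eq0.
by apply: contraNneq p0 => q00; rewrite -lead_coef_eq0 -q0 q00 horner0.
Qed.

Lemma local_expansionD f g P :
  local_expansion (f + g) P = local_expansion f P + local_expansion g P.
Proof.
case: P => [a|] /=; first by rewrite composeD //; exact: nonconstant_shift.
rewrite composeD; last exact: nonconstant_invX.
by rewrite mulrDl opprD.
Qed.

Lemma local_expansion0 P : local_expansion 0 P = 0 :> F.
Proof.
by apply: (addrI (local_expansion 0 P)); rewrite -local_expansionD !addr0.
Qed.

Lemma local_expansionN f P : local_expansion (- f) P = - local_expansion f P.
Proof.
by apply/eqP; rewrite -addr_eq0 -local_expansionD addNr local_expansion0.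
Qed.

Lemma local_expansion_sum (I : finType) (g : I -> F) P :
  local_expansion (\sum_i g i) P = \sum_i local_expansion (g i) P.
Proof.
apply: (big_morph (fun f => local_expansion f P)) => [f g'|].
  exact: local_expansionD.
exact: local_expansion0.
Qed.

Definition simple_fraction (r a : K) : F := iota r%:P / iota ('X - a%:P).

Lemma simple_fraction_finite (r a b : K) :
  is_polar_part (local_expansion (simple_fraction r a) (Some b))
    (if a == b then r *: 'X else 0).
Proof.
apply/polar_partP; split.
  by case: ifP; rewrite ?coefZ ?coefX ?coef0 ?mulr0.
rewrite /= composeE; [|exact: nonconstant_shift|by rewrite polyXsubC_eq0].
rewrite eval_atC eval_at_iota comp_polyB comp_polyX comp_polyC.
case: eqVneq => [->|ab].
  rewrite addrK eval_atZ eval_atX subrr -(rmorph0 iota).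
  exact: regular0_poly.
rewrite eval_at0 subr0; exists r%:P, ('X + b%:P - a%:P).
by rewrite !hornerE subr_eq0 eq_sym.
Qed.

(** Since [dz = - dw / w^2], the form [r dz / (z - a)] is
    [- r dw / (w (1 - a w))] near infinity, where it has a simple pole of residue
    [- r]. *)
Lemma simple_fraction_infinity (r a : K) :
  is_polar_part (local_expansion (simple_fraction r a) None) (- r *: 'X).
Proof.
apply/polar_partP; split; first by rewrite coefZ coefX mulr0.
rewrite /= composeE; [|exact: nonconstant_invX|by rewrite polyXsubC_eq0].
rewrite eval_atC eval_atB eval_atX eval_atC eval_atZ eval_atX.
exists (- (r * a)%:P), (1 - a%:P * 'X); split.
  by rewrite hornerD hornerN hornerM hornerX mulr0 subr0 hornerC oner_neq0.
have d0 : (1 - a%:P * 'X : {poly K}).[0] != 0.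
  by rewrite hornerD hornerN hornerM hornerX mulr0 subr0 hornerC oner_neq0.
have := den_neq0 d0; have w0 := w_neq0.
rewrite polyCN polyCM !rmorphN !rmorphB !rmorphM /= rmorph1 => h.
have h2 : w^-1 - iota a%:P = (1 - iota a%:P * w) / w.
  by rewrite mulrBl mul1r mulfK.
rewrite h2; by field; rewrite w0 h.
Qed.

(** As [K] is algebraically closed, a nonconstant denominator has a root [a]; no
    pole at [a] means that [a] is a root of the numerator too, so a common factor
    cancels. Induct on the size of the denominator. *)
Lemma no_finite_pole g : (forall a, regular0 (local_expansion g (Some a))) ->
  exists p, g = iota p.
Proof.
have [n [d [d0 ->]]] := fractionP g.
move: {2}(size d) (leqnn (size d)) => k; move: n d d0.
elim: k => [|k IH] n d d0; first by rewrite leqn0 size_poly_eq0 (negPf d0).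
move=> sd hreg.
have [/size1_polyC Ed|sd1] := leqP (size d) 1.
  exists (n * (d`_0)^-1%:P); apply/eqP.
  have c0 : d`_0 != 0 by rewrite -polyC_eq0 -Ed.
  have td : iota d != 0 by rewrite iota_eq0.
  rewrite -(inj_eq (mulIf td)) (divfK td) -rmorphM iota_eq {2}Ed.
  by rewrite -mulrA -polyCM (mulVf c0) mulr1.
have /closed_rootP[a ra] : size d != 1%N by rewrite neq_ltn sd1 orbT.
have rn : root n a.
  have [n' [d' [d'0 E]]] := hreg a; move: E.
  rewrite /= composeE //; last exact: nonconstant_shift.
  rewrite !eval_at_iota => /eqP; rewrite eqr_div; first last.
  - exact: den_neq0.
  - by rewrite iota_eq0 comp_poly_eq0 // size_XaddC.
  rewrite -!rmorphM iota_eq => /eqP/(congr1 (fun r => r.[0])).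
  rewrite !hornerM !horner_comp !hornerE (eqP ra) mulr0 => /eqP.
  by rewrite mulf_eq0 (negPf d'0) orbF.
have /factor_theorem[n1 En] := rn; have /factor_theorem[d1 Ed] := ra.
have d10 : d1 != 0 by apply: contraNneq d0; rewrite Ed => ->; rewrite mul0r.
have E : iota n / iota d = iota n1 / iota d1 :> F.
  rewrite En Ed !rmorphM /= -mulf_div divff ?mulr1 //.
  by rewrite iota_eq0 polyXsubC_eq0.
rewrite E; apply: IH => // [|a']; last by rewrite -E.
by move: sd; rewrite Ed size_mul ?polyXsubC_eq0 // size_XsubC addn2.
Qed.

(** The form with residue [r i] at each finite [P i]; the residue at infinity
    is not prescribed, but forced by the finite ones. *)
Definition fraction_sum (I : finType) (r : I -> K) (P : I -> option K) : F :=
  \sum_i (if P i is Some a then simple_fraction (r i) a else 0).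

Lemma fraction_sum_finite (I : finType) (r : I -> K) (P : I -> option K) b :
  is_polar_part (local_expansion (fraction_sum r P) (Some b))
    ((\sum_(i | P i == Some b) r i) *: 'X).
Proof.
rewrite local_expansion_sum scaler_suml.
rewrite [X in is_polar_part _ X]big_mkcond; apply: is_polar_part_sum => i.
case: (P i) => [a|]; last by rewrite local_expansion0; exact: is_polar_part0.
exact: simple_fraction_finite.
Qed.

Lemma fraction_sum_infinity (I : finType) (r : I -> K) (P : I -> option K) :
  is_polar_part (local_expansion (fraction_sum r P) None)
    (- (\sum_(i | P i != None) r i) *: 'X).
Proof.
rewrite local_expansion_sum -sumrN scaler_suml.
rewrite [X in is_polar_part _ X]big_mkcond; apply: is_polar_part_sum => i.
case: (P i) => [a|]; last by rewrite local_expansion0; exact: is_polar_part0.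
exact: simple_fraction_infinity.
Qed.

(** When the residues add up to 0, the residue at infinity is also the one that
    the configuration asks for, so that infinity needs no special treatment. *)
Lemma fraction_sum_polar_part (I : finType) (r : I -> K) (P : I -> option K) Q :
  \sum_i r i = 0 ->
  is_polar_part (local_expansion (fraction_sum r P) Q)
    ((\sum_(i | P i == Q) r i) *: 'X).
Proof.
case: Q => [b|] r0; first exact: fraction_sum_finite.
have -> : \sum_(i | P i == None) r i = - \sum_(i | P i != None) r i.
  by move/eqP: r0; rewrite (bigID (fun i => P i == None)) /= addr_eq0 => /eqP.
exact: fraction_sum_infinity.
Qed.

(** A form whose poles are all simple is the sum of its simple fractions, and its
    residues add up to 0. Indeed the difference [g] has no finite pole, hence is
    a polynomial [p]; at infinity [g] reads [- p(1/w) / w^2], which has a pole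
    of order at least 2 unless [p = 0], whereas both forms have at most a simple
    pole there. *)
Lemma partial_fractions (I : finType) (P : I -> option K) f
    (c : option K -> K) :
  injective P -> (forall Q, is_polar_part (local_expansion f Q) (c Q *: 'X)) ->
  (forall Q, (forall i, P i != Q) -> c Q = 0) ->
  f = fraction_sum (c \o P) P /\ \sum_i c (P i) = 0.
Proof.
move=> injP fP c0.
have cE Q : \sum_(i | P i == Q) c (P i) = c Q.
  have [/existsP[i /eqP <-]|/existsPn nQ] := boolP [exists i, P i == Q].
    by rewrite (big_pred1 i) // => j; rewrite (inj_eq injP).
  by rewrite c0 // big_pred0 // => i; apply/negbTE.
pose g := f - fraction_sum (c \o P) P.
have [p Ep] : exists p, g = iota p.
  apply: no_finite_pole => b.
  have := is_polar_partD (fP (Some b))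
    (is_polar_partN (fraction_sum_finite (c \o P) P b)).
  rewrite cE subrr -local_expansionN -local_expansionD => /polar_partP[_].
  by rewrite eval_at0 subr0.
have := is_polar_partD (fP None)
  (is_polar_partN (fraction_sum_infinity (c \o P) P)).
rewrite -local_expansionN -local_expansionD -/g Ep /=.
rewrite compose_poly; last exact: nonconstant_invX.
rewrite -scaleNr opprK -scalerDl => /polar_partP[_].
set e := (X in X *: 'X).
have -> : - (eval_at p w^-1 / w ^+ 2) - eval_at (e *: 'X) w^-1 =
    eval_at (- (p * 'X^2) - e *: 'X) w^-1.
  rewrite eval_atB -[- (p * _)]sub0r eval_atB eval_at0 sub0r eval_atM.
  by rewrite [eval_at 'X^2 _]eval_atE map_polyXn hornerXn exprVn.
move=> /regular0_eval_at_invX sz.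
have coefS j : (- (p * 'X^2) - e *: 'X)`_j.+1 = 0.
  by apply/(leq_sizeP _ 1%N).
have p0 : p = 0.
  apply/polyP => j; have := coefS j.+1.
  rewrite coefB coefN coefMXn coefZ coefX /= !subSS subn0 mulr0 subr0 coef0.
  by move/eqP; rewrite oppr_eq0 => /eqP.
have e0 : e = 0.
  have := coefS 0%N; rewrite p0 mul0r oppr0 sub0r coefN coefZ coefX mulr1.
  by move/eqP; rewrite oppr_eq0 => /eqP.
split; first by apply/eqP; rewrite -subr_eq0 -/g Ep p0 rmorph0.
by rewrite (bigID (fun i => P i == None)) /= cE.
Qed.

End PrincipalParts.

(** * Forms with simple poles *)
Section Forms.
Variables (R : realType) (s : nat).
Local Notation C := R[i].
Implicit Types (x y : config R s).

Lemma ratfun_numden (f : ratfun R) :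
  let nd := frac (generic_quotient.repr f) in
  nd.2 != 0 /\ f = tofrac nd.1 / tofrac nd.2.
Proof.
have dn0 := denom_ratioP (generic_quotient.repr f); split => //.
rewrite -{1}[f]reprK /GRing.mul /GRing.inv /=.
rewrite !piE /FracField.mulf /FracField.invf.
rewrite !(numer_Ratio, denom_Ratio) ?oner_neq0 //.
by rewrite mul1r mulr1 Ratio_numden.
Qed.

Local Notation iota := (@tofrac {poly C}).

Lemma tofrac_inj : injective iota.
Proof. by move=> p q /eqP; rewrite tofrac_eq => /eqP. Qed.

Lemma ratfun_compP (f u : ratfun R) : exists n d : {poly C},
  [/\ d != 0, f = iota n / iota d &
      ratfun_comp f u = eval_at iota n u / eval_at iota d u].
Proof.
have [d0 E] := ratfun_numden f; set nd := frac (generic_quotient.repr f).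
by exists nd.1, nd.2; split.
Qed.

Lemma principal_partP (f : ratfun R) P :
  is_polar_part iota (local_expansion iota (@ratfun_comp R) f P)
    (principal_part f P).
Proof.
exact: (xgetPex 0 (polar_part_exists tofrac_inj ratfun_compP (local_form f P))).
Qed.

Lemma principal_part_eq (f : ratfun R) P q :
  is_polar_part iota (local_expansion iota (@ratfun_comp R) f P) q ->
  principal_part f P = q.
Proof.
move=> fPq; exact: (polar_part_unique tofrac_inj (principal_partP f P) fPq).
Qed.

Definition form_of (x : config R s) : ratfun R := fraction_sum iota x.1 x.2.

Lemma principal_part_form_of x P : \sum_i x.1 i = 0 ->
  principal_part (form_of x) P =
  (\sum_(i | (x.2 i : option C) == P) x.1 i) *: 'X.
Proof.
move=> x0; apply: principal_part_eq.
exact: (fraction_sum_polar_part tofrac_inj ratfun_compP).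
Qed.

Lemma residue_form_of x P : \sum_i x.1 i = 0 ->
  residue (form_of x) P = \sum_(i | (x.2 i : option C) == P) x.1 i.
Proof.
by move=> x0; rewrite /residue principal_part_form_of // coefZ coefX mulr1.
Qed.

Lemma pole_order_form_of x P : \sum_i x.1 i = 0 ->
  pole_order (form_of x) P = (residue (form_of x) P != 0).
Proof.
move=> x0; rewrite residue_form_of // /pole_order principal_part_form_of //.
set c := \sum_(_ | _) _; have [->|c0] := eqVneq c 0.
  by rewrite scale0r size_poly0.
by rewrite size_scale // size_polyX.
Qed.

Lemma residue_form_of_pole x i :
  configs x -> residue (form_of x) (x.2 i) = x.1 i.
Proof.
move=> [_ x0 xi]; rewrite residue_form_of // (big_pred1 i) // => j.
by apply/eqP/eqP => [/xi|->].
Qed.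

Lemma poles_form_of x : configs x -> poles (form_of x) = range x.2.
Proof.
move=> cx; have [xn0 x0 xi] := cx; apply/seteqP; split => P /=.
  rewrite /poles /= pole_order_form_of // lt0b residue_form_of // => rP.
  apply: contrapT => nP; move/negP: rP; apply; rewrite big_pred0 // => i.
  by apply/negP => /eqP iP; apply: nP; exists i.
move=> [i _ <-]; rewrite /poles /= pole_order_form_of // lt0b.
by rewrite residue_form_of_pole.
Qed.

Lemma card_range_ord (T : Type) (p : 'I_s -> T) :
  injective p -> (range p #= `I_s)%card.
Proof.
move=> pI; have [s0|s0] := posnP s.
  have -> : range p = set0.
    apply/seteqP; split => [y [j]|y //].
    have := leq_ltn_trans (leq0n j) (ltn_ord j).
    by rewrite [X in (0 < X)%N]s0.
  by rewrite s0 II0 card_eq0.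
pose h k := p (insubd (Ordinal s0) k).
have -> : range p = [set h k | k in `I_s].
  apply/seteqP; split => [_ [i _ <-]|_ [k ks <-]]; last by eexists.
  exists (i : nat) => //=; rewrite /h; congr p; apply: val_inj.
  by rewrite /= val_insubd ltn_ord.
apply: inj_card_eq => i j; rewrite !inE /= => ils jls /pI/(congr1 val).
by rewrite /= !val_insubd ils jls.
Qed.

Lemma form_of_Omega x : configs x -> Omega R s (form_of x).
Proof.
move=> cx; have [xn0 x0 xi] := cx; split.
  by rewrite poles_form_of //; exact: card_range_ord.
move=> P; rewrite /poles /= pole_order_form_of //; by case: (_ != 0).
Qed.

(** The numberings of the poles of [form_of x] are those of [x] up to a
    permutation, which is found by choosing for each pole its index in [x]. *)
Lemma residue_class_form_of x : configs x ->
  @residue_class R s (form_of x) = config_class x.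
Proof.
move=> cx; have [xn0 x0 xi] := cx; apply/seteqP; split => [y|y [sigma ->]] /=.
  move=> [yi]; rewrite poles_form_of // => yx yr.
  have /(_ _)/cid-/all_sig[t Et] i : exists j, x.2 j = y.2 i.
    have : range x.2 (y.2 i) by rewrite -yx; exists i.
    by move=> [j _ <-]; exists j.
  have ti : injective t by move=> i j tij; apply: yi; rewrite -!Et tij.
  exists (perm ti); rewrite [y]surjective_pairing.
  congr pair; apply/funext => i /=.
    by rewrite permE yr -Et residue_form_of_pole.
  by rewrite permE Et.
split => [|/=|i /=]; first by apply: inj_comp => //; exact: perm_inj.
  rewrite poles_form_of //; apply/seteqP; split => [_ [i _ <-]|_ [i _ <-]].
    by exists (sigma i).
  by exists (sigma^-1%g i); rewrite //= permKV.
by rewrite residue_form_of_pole.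
Qed.

(** Together with [form_of_Omega] and [residue_class_form_of], this is the
    bijection between forms and classes of configurations. *)
Lemma Omega_form_of f : Omega R s f -> exists2 x, configs x & f = form_of x.
Proof.
move=> [/card_set_bijP[h [hf hi hs]] simple].
have /(_ _)/cid2-/all_sig2[p pP pE] (i : 'I_s) : exists2 P, poles f P & h P = i.
  by apply: hs; exact: ltn_ord.
have pI : injective p by move=> i j pij; apply: val_inj; rewrite /= -!pE pij.
have ppE P : principal_part f P = residue f P *: 'X.
  have [q0 _] := principal_partP f P.
  have sz : (size (principal_part f P) <= 2)%N.
    have [fP|/negP] := boolP (0 < pole_order f P)%N.
      by have := simple P fP; rewrite /pole_order; case: size => [|[|[]]].
    by rewrite /pole_order => /negP; rewrite -leqNgt; case: size => [|[]].
  apply/polyP => -[|[|j]]; rewrite coefZ coefX ?mulr0 ?mulr1 //.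
  by apply/(leq_sizeP _ 2%N sz).
have res0 P : residue f P = 0 <-> ~ poles f P.
  rewrite /poles /= /pole_order ppE; have [->|r0] := eqVneq (residue f P) 0.
    by rewrite scale0r size_poly0.
  by rewrite size_scale // size_polyX; split=> [/eqP|//]; rewrite (negPf r0).
have [||E0 E1] := @partial_fractions _ _ iota tofrac_inj _ ratfun_compP
  _ p f (residue f) pI.
- by move=> P; rewrite -ppE; exact: principal_partP.
- move=> P Pp; apply/res0 => fP.
  have hP : (h P < s)%N by apply: hf.
  have := Pp (Ordinal hP); move/eqP; apply.
  by apply: hi; rewrite ?inE //; exact: pE.
exists (residue f \o p, p); last exact: E0.
by split=> //= i; apply/eqP => /res0; apply.
Qed.

Lemma config_class_eqP x y : config_class x = config_class y <->
  exists sigma : 'S_s, y = (x.1 \o sigma, x.2 \o sigma).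
Proof.
split=> [xy|[sigma ->]].
  suff : config_class y y by rewrite -xy.
  exists 1%g; rewrite [LHS]surjective_pairing.
  by congr pair; apply/funext => i /=; rewrite perm1.
apply/seteqP; split => [_ [tau ->]|_ [tau ->]] /=.
  exists (tau * sigma^-1)%g; congr pair; apply/funext => i /=;
  by rewrite permM permKV.
by exists (tau * sigma)%g; congr pair; apply/funext => i /=; rewrite permM.
Qed.

Lemma form_of_class x y :
  config_class x = config_class y -> form_of x = form_of y.
Proof.
move=> /config_class_eqP[sigma ->]; rewrite /form_of /fraction_sum.
exact: (reindex_inj (@perm_inj _ sigma)).
Qed.

Lemma configs_perm x (sigma : 'S_s) :
  configs x -> configs (x.1 \o sigma, x.2 \o sigma).
Proof.
move=> [xn0 x0 xi]; split=> /= [i //||].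
  by move: x0; rewrite (reindex_inj (@perm_inj _ sigma)).
by apply: inj_comp => //; exact: perm_inj.
Qed.

End Forms.

(** * The expansion of 1/(1-a-b) in two variables *)
Section BinomialSquares.
Variable K : comPzRingType.
Implicit Types a b : K.

Definition binomial_term a b (p q : nat) : K := a ^+ p * b ^+ q *+ 'C(p + q, p).

Definition square_sum a b N := \sum_(p < N) \sum_(q < N) binomial_term a b p q.

(** The terms left over in [square_sum_pascal], that is the relative error of
    [square_sum a b N.+1] as an approximation of [1 / (1 - a - b)]. *)
Definition square_boundary a b N :=
  a * (\sum_(q < N.+1) binomial_term a b N q) +
  b * (\sum_(p < N.+1) binomial_term a b p N).

Lemma binomial_term00 a b : binomial_term a b 0 0 = 1.
Proof. by rewrite /binomial_term !expr0 mulr1 bin0. Qed.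

Lemma binomial_termS0 a b p :
  binomial_term a b p.+1 0 = a * binomial_term a b p 0.
Proof. by rewrite /binomial_term !addn0 !binn !mulr1n exprS mulrA. Qed.

Lemma binomial_term0S a b q :
  binomial_term a b 0 q.+1 = b * binomial_term a b 0 q.
Proof. by rewrite /binomial_term !bin0 !mulr1n exprS !expr0 !mul1r. Qed.

Lemma binomial_termSS a b p q : binomial_term a b p.+1 q.+1 =
  a * binomial_term a b p q.+1 + b * binomial_term a b p.+1 q.
Proof.
rewrite /binomial_term -!mulrnAr addSn binS mulrnDr addnS -addSn.
rewrite mulrDr addrC !exprS -!mulrnAr.
by congr (_ + _); rewrite -?mulrnAr ?mulrnAr; ring.
Qed.

Lemma binomial_termM a b x y p q :
  binomial_term (a * x) (b * y) p q = binomial_term a b p q * (x ^+ p * y ^+ q).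
Proof. by rewrite /binomial_term !exprMn mulrACA mulrnAl. Qed.

(** Pascal's rule says that every term of the square but the first is [a] times
    its neighbour on one side plus [b] times its neighbour on the other; so
    multiplying by [1 - a - b] cancels everything except the terms of two edges
    of the square, and no rearrangement into powers of [a + b] is needed. *)
Lemma square_sum_pascal a b N :
  square_sum a b N.+1 * (1 - a - b) = 1 - square_boundary a b N.
Proof.
set t := binomial_term a b.
pose X := \sum_(p < N) \sum_(q < N.+1) t p q.
pose Y := \sum_(p < N.+1) \sum_(q < N) t p q.
have EX : square_sum a b N.+1 = X + \sum_(q < N.+1) t N q.
  by rewrite /square_sum big_ord_recr.
have EY : square_sum a b N.+1 = Y + \sum_(p < N.+1) t p N.
  rewrite /square_sum -big_split /=; apply: eq_bigr => p _.
  by rewrite big_ord_recr.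
have ES : square_sum a b N.+1 = 1 + a * X + b * Y.
  rewrite /square_sum big_ord_recl big_ord_recl /= -/t {1}/t binomial_term00.
  have -> : \sum_(i < N) t 0%N (bump 0 i) = b * \sum_(q < N) t 0%N q.
    by rewrite mulr_sumr; apply: eq_bigr => q _; rewrite /t binomial_term0S.
  have -> : \sum_(i < N) \sum_(q < N.+1) t (bump 0 i) q =
      a * X + b * \sum_(p < N) \sum_(q < N) t p.+1 q.
    rewrite !mulr_sumr -big_split; apply: eq_bigr => p _ /=.
    rewrite !big_ord_recl /= /bump /= !add1n /t binomial_termS0 mulrDr -addrA.
    congr (_ + _); rewrite !mulr_sumr -big_split; apply: eq_bigr => q _ /=.
    by rewrite !add1n binomial_termSS.
  by rewrite [Y]big_ord_recl mulrDr /= addrACA addrA; congr (_ + _ + _ * _).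
rewrite mulrBr mulrBr mulr1 {1}ES {1}EX EY /square_boundary -/t; ring.
Qed.

End BinomialSquares.

Lemma sum_squareS (V : nmodType) (g : nat -> nat -> V) N :
  \sum_(p < N.+1) \sum_(q < N.+1) g p q =
  \sum_(p < N) \sum_(q < N) g p q +
  (\sum_(p < N) g p N + \sum_(q < N.+1) g N q).
Proof.
rewrite big_ord_recr /= addrA; congr (_ + _).
by rewrite -big_split; apply: eq_bigr => p _; rewrite big_ord_recr.
Qed.

Lemma sum_square_nondecreasing (R : realType) (g : nat -> nat -> R) :
  (forall p q, 0 <= g p q) ->
  nondecreasing_seq (fun N : nat => \sum_(p < N) \sum_(q < N) g p q).
Proof.
move=> g0; apply/nondecreasing_seqP => N; rewrite sum_squareS lerDl.
by rewrite addr_ge0 // sumr_ge0.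
Qed.

Section BinomialSquaresReal.
Variable R : realType.
Variables a b : R.
Hypotheses (a0 : 0 <= a) (b0 : 0 <= b) (ab1 : a + b < 1).

Lemma binomial_term_ge0 p q : 0 <= binomial_term a b p q.
Proof. by rewrite /binomial_term mulrn_wge0 // mulr_ge0 ?exprn_ge0. Qed.

Lemma square_boundary_ge0 N : 0 <= square_boundary a b N.
Proof.
by rewrite addr_ge0 // mulr_ge0 // sumr_ge0 // => i _; exact: binomial_term_ge0.
Qed.

Lemma square_sum_ge N : square_sum a b N <= (1 - a - b)^-1.
Proof.
have d0 : 0 < 1 - a - b by rewrite -addrA -opprD subr_gt0.
case: N => [|N]; first by rewrite /square_sum big_ord0 invr_ge0 ltW.
rewrite -[leRHS]mul1r ler_pdivlMr // square_sum_pascal.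
by rewrite lerBlDr lerDl square_boundary_ge0.
Qed.

Lemma square_sum_cvg : cvgn (square_sum a b).
Proof.
apply: nondecreasing_is_cvgn.
  exact: sum_square_nondecreasing binomial_term_ge0.
by exists (1 - a - b)^-1 => _ [N _ <-]; exact: square_sum_ge.
Qed.

(** The last row and the last column are parts of the increment of the square
    sums, which tends to 0 because these sums converge. *)
Lemma square_boundary_le N : square_boundary a b N <=
  2 * (square_sum a b N.+1 - square_sum a b N).
Proof.
have le1 x y : 0 <= x -> x <= 1 -> 0 <= y -> x * y <= y.
  by move=> x0 x1 y0; rewrite ler_piMl.
have pos := binomial_term_ge0.
have H1 : \sum_(q < N.+1) binomial_term a b N q <=
    square_sum a b N.+1 - square_sum a b N.
  by rewrite lerBrDl [leRHS]sum_squareS lerD2l lerDr sumr_ge0.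
have H2 : \sum_(p < N.+1) binomial_term a b p N <=
    square_sum a b N.+1 - square_sum a b N.
  rewrite lerBrDl [leRHS]sum_squareS lerD2l big_ord_recr /= lerD2l.
  by rewrite big_ord_recr /= lerDr sumr_ge0.
rewrite mulr_natl mulr2n; apply: lerD.
  apply: le_trans H1; apply: le1 => //; last by rewrite sumr_ge0.
  by apply: ltW; apply: le_lt_trans ab1; rewrite lerDl.
apply: le_trans H2; apply: le1 => //; last by rewrite sumr_ge0.
by apply: ltW; apply: le_lt_trans ab1; rewrite lerDr.
Qed.

Lemma square_boundary_cvg0 : square_boundary a b @ \oo --> (0 : R).
Proof.
apply: (@squeeze_cvgr _ _ _ _ (fun=> 0)
  (fun N => 2 * (square_sum a b N.+1 - square_sum a b N))).
- by near=> N; rewrite square_boundary_ge0 square_boundary_le.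
- exact: cvg_cst.
have -> : (0 : R) = 2 * (limn (square_sum a b) - limn (square_sum a b)).
  by rewrite subrr mulr0.
apply: cvgMr; apply: cvgB; last exact: square_sum_cvg.
rewrite (@cvg_shiftS _ (square_sum a b)); exact: square_sum_cvg.
Unshelve. all: by end_near.
Qed.

End BinomialSquaresReal.

Section ComplexNorm.
Variable R : realType.
Local Notation C := R[i].
Local Notation normc := (@ComplexField.Normc.normc R).

Lemma normc_ge0 (z : C) : 0 <= normc z.
Proof. by case: z => x y; exact: sqrtr_ge0. Qed.

Lemma normc_gt0 (z : C) : z != 0 -> 0 < normc z.
Proof.
move=> z0; rewrite lt_neqAle normc_ge0 andbT eq_sym.
by apply: contra z0 => /eqP/ComplexField.Normc.eq0_normc ->.
Qed.

Lemma normcX (z : C) n : normc (z ^+ n) = normc z ^+ n.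
Proof.
elim: n => [|n IH]; first by rewrite !expr0 -[RHS](@ComplexField.Normc.normc1 R).
by rewrite !exprS ComplexField.Normc.normcM IH.
Qed.

Lemma normc_real (r : R) : normc r%:C = `|r|.
Proof. by rewrite /= expr0n /= addr0 sqrtr_sqr. Qed.

Lemma normc_i : normc 'i = 1.
Proof. by rewrite /= expr0n /= add0r expr1n sqrtr1. Qed.

Lemma normc_sum (I : finType) (f : I -> C) :
  normc (\sum_i f i) <= \sum_i normc (f i).
Proof.
elim/big_ind2: _ => //; first by rewrite -[leRHS](@ComplexField.Normc.normc0 R).
by move=> x1 x2 y1 y2 h1 h2; apply: le_trans (le_normcD _ _) _; exact: lerD.
Qed.

Lemma normc_binomial_term (a b : C) p q :
  normc (binomial_term a b p q) = binomial_term (normc a) (normc b) p q.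
Proof.
rewrite /binomial_term -mulr_natr ComplexField.Normc.normcM.
rewrite ComplexField.Normc.normcM !normcX.
have -> : ('C(p + q, p)%:R : C) = ('C(p + q, p)%:R)%:C by rewrite rmorph_nat.
by rewrite normc_real normr_nat mulr_natr.
Qed.

Lemma normc_square_boundary (a b : C) N :
  normc (square_boundary a b N) <= square_boundary (normc a) (normc b) N.
Proof.
apply: le_trans (le_normcD _ _) _; rewrite !ComplexField.Normc.normcM.
apply: lerD; rewrite ler_wpM2l ?normc_ge0 //; apply: le_trans (normc_sum _) _;
  by apply: ler_sum => i _; rewrite normc_binomial_term.
Qed.

Lemma Re_le_normc (z : C) : `|complex.Re z| <= normc z.
Proof. by case: z => x y /=; rewrite -sqrtr_sqr ler_wsqrtr // lerDl sqr_ge0. Qed.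

Lemma Im_le_normc (z : C) : `|complex.Im z| <= normc z.
Proof. by case: z => x y /=; rewrite -sqrtr_sqr ler_wsqrtr // lerDr sqr_ge0. Qed.

End ComplexNorm.

(** * Real analytic functions *)
Section TwoVariables.
Variables (R : realType) (m : nat).
Implicit Types (f : 'rV[R]_m -> R) (x h : 'rV[R]_m).

Definition supported2 (i j : 'I_m) (a : 'I_m -> nat) :=
  [forall k, (k != i) && (k != j) ==> (a k == 0%N)].

(** Multi-indices that vanish outside [{i, j}] are pairs of exponents. *)
Lemma sum_supported2 (i j : 'I_m) (g : nat -> nat -> R) N : i != j ->
  \sum_(a : {ffun 'I_m -> 'I_N})
     (if supported2 i j (fun k => a k) then g (a i) (a j) else 0) =
  \sum_(p < N) \sum_(q < N) g p q.
Proof.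
move=> ij; case: N => [|N].
  by rewrite big_ord0 big1 // => a; case: (a i).
rewrite pair_big /= -big_mkcond /=.
pose F (u : 'I_N.+1 * 'I_N.+1) : {ffun 'I_m -> 'I_N.+1} :=
  [ffun k => if k == i then u.1 else if k == j then u.2 else ord0].
have Fi u : F u i = u.1 by rewrite ffunE eqxx.
have Fj u : F u j = u.2 by rewrite ffunE eq_sym (negPf ij) eqxx.
rewrite (reindex_onto F (fun a => (a i, a j))) /=.
  apply: eq_big => [u|u _]; rewrite Fi Fj // -surjective_pairing eqxx andbT.
  apply/forallP => k; apply/implyP => /andP[ki kj].
  by rewrite ffunE (negPf ki) (negPf kj).
move=> a /forallP supp; apply/ffunP => k; rewrite ffunE /=.
case: eqVneq => [->//|ki]; case: eqVneq => [->//|kj].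
have := supp k; rewrite ki kj /= => /eqP k0; exact: val_inj.
Qed.

(** A double power series, summed over squares, gives a power series in any
    number of variables, summed over cubes. *)
Lemma real_analytic_two_variables f x (i j : 'I_m) (c : nat -> nat -> R)
    (G : R -> R -> R) (e : R) : i != j -> 0 < e ->
  (forall y, f y = G (y 0 i) (y 0 j)) ->
  (forall h k : R, `|h| < e -> `|k| < e ->
    cvgn (fun N => \sum_(p < N) \sum_(q < N) `|c p q * (h ^+ p * k ^+ q)|) /\
    (fun N => \sum_(p < N) \sum_(q < N) c p q * (h ^+ p * k ^+ q)) @ \oo -->
      G (x 0 i + h) (x 0 j + k)) ->
  real_analytic_at f x.
Proof.
move=> ij e0 fG cG.
pose c' (a : 'I_m -> nat) := if supported2 i j a then c (a i) (a j) else 0.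
have termE h (a : 'I_m -> nat) : power_series_term c' h a =
    if supported2 i j a then c (a i) (a j) * (h 0 i ^+ a i * h 0 j ^+ a j)
    else 0.
  rewrite /power_series_term /c'.
  case: ifPn => [/forallP supp|_]; last by rewrite mul0r.
  congr (_ * _); rewrite (bigD1 i) //= (bigD1 j) ?(eq_sym j) //= big1 ?mulr1 //.
  by move=> k; have := supp k => /implyP h1 h2; rewrite (eqP (h1 h2)) expr0.
exists c', e; split => // h he.
have [c1 c2] := cG (h 0 i) (h 0 j) (he i) (he j).
split.
  suff -> : (fun N : nat => \sum_(a : {ffun 'I_m -> 'I_N})
      `|power_series_term c' h (fun i => a i : nat)|) =
      (fun N => \sum_(p < N) \sum_(q < N)
        `|c p q * (h 0 i ^+ p * h 0 j ^+ q)|) by [].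
  apply/funext => N.
  rewrite -(sum_supported2
    (fun p q => `|c p q * (h 0 i ^+ p * h 0 j ^+ q)|) _ ij).
  by apply: eq_bigr => a _; rewrite termE; case: ifP => // _; rewrite normr0.
rewrite fG !mxE.
suff -> : (fun N : nat => \sum_(a : {ffun 'I_m -> 'I_N})
    power_series_term c' h (fun i => a i : nat)) =
    (fun N => \sum_(p < N) \sum_(q < N) c p q * (h 0 i ^+ p * h 0 j ^+ q)) by [].
apply/funext => N.
rewrite -(sum_supported2 (fun p q => c p q * (h 0 i ^+ p * h 0 j ^+ q)) _ ij).
by apply: eq_bigr => a _; rewrite termE.
Qed.

Lemma real_analytic0 x : real_analytic_at (fun=> 0) x.
Proof.
exists (fun=> 0), 1; split => // h _.
have E (a : 'I_m -> nat) : power_series_term (fun=> 0) h a = 0.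
  by rewrite /power_series_term mul0r.
split.
  under eq_fun do under eq_bigr do rewrite E normr0.
  by under eq_fun do rewrite big1 //; exact: is_cvg_cst.
under eq_fun do under eq_bigr do rewrite E.
by under eq_fun do rewrite big1 //; exact: cvg_cst.
Qed.

Lemma real_analyticN f x : real_analytic_at f x ->
  real_analytic_at (fun y => - f y) x.
Proof.
move=> [c [e [e0 H]]]; exists (fun a => - c a), e; split => // h /H[H1 H2].
have E (a : 'I_m -> nat) :
    power_series_term (fun a => - c a) h a = - power_series_term c h a.
  by rewrite /power_series_term mulNr.
split; first by under eq_fun do under eq_bigr do rewrite E normrN.
under eq_fun do under eq_bigr do rewrite E.
by under eq_fun do rewrite sumrN; exact: cvgN.
Qed.

Lemma cube_sum_nondecreasing (u : ('I_m -> nat) -> R) : (forall a, 0 <= u a) ->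
  nondecreasing_seq
    (fun N : nat => \sum_(a : {ffun 'I_m -> 'I_N}) u (fun i => a i : nat)).
Proof.
move=> u0; apply/nondecreasing_seqP => N.
pose F (a : {ffun 'I_m -> 'I_N}) : {ffun 'I_m -> 'I_N.+1} :=
  [ffun k => widen_ord (leqnSn N) (a k)].
have F_inj : injective F.
  move=> a b /ffunP ab; apply/ffunP => k; apply: val_inj.
  by have := congr1 val (ab k); rewrite !ffunE.
rewrite [leRHS](bigID (mem [set F a | a in [set: {ffun 'I_m -> 'I_N}]]%SET)) /=.
rewrite (big_imset
    (fun a : {ffun 'I_m -> 'I_N.+1} => u (fun i => a i : nat)));
  last by move=> a b _ _; exact: F_inj.
apply: (@le_trans _ _
  (\sum_(a in [set: {ffun 'I_m -> 'I_N}]%SET) u (fun i => F a i : nat))).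
  rewrite le_eqVlt; apply/orP; left; apply/eqP.
  apply: eq_big => [a|a _]; first by rewrite inE.
  by congr u; apply/funext => k; rewrite ffunE.
by rewrite lerDl sumr_ge0.
Qed.

(** The absolute partial sums of the sum of two series are monotone, and bounded
    by the sum of the two limits. *)
Lemma real_analyticD f g x : real_analytic_at f x -> real_analytic_at g x ->
  real_analytic_at (fun y => f y + g y) x.
Proof.
move=> [c [e [e0 H]]] [c' [e' [e'0 H']]].
exists (fun a => c a + c' a), (Num.min e e'); split; first by rewrite lt_min e0.
move=> h he.
have /H[H1 H2] i : `|h 0 i| < e by have := he i; rewrite lt_min => /andP[].
have /H'[H3 H4] i : `|h 0 i| < e' by have := he i; rewrite lt_min => /andP[].
have E (a : 'I_m -> nat) : power_series_term (fun a => c a + c' a) h a =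
    power_series_term c h a + power_series_term c' h a.
  by rewrite /power_series_term mulrDl.
split; last first.
  under eq_fun do under eq_bigr do rewrite E.
  by under eq_fun do rewrite big_split; exact: cvgD.
under eq_fun do under eq_bigr do rewrite E.
have nd d :=
  cube_sum_nondecreasing (fun a => normr_ge0 (power_series_term d h a)).
apply: nondecreasing_is_cvgn.
  have := nd (fun a => c a + c' a).
  by under eq_fun do under eq_bigr do rewrite E.
exists (limn (fun N : nat => \sum_(a : {ffun 'I_m -> 'I_N})
          `|power_series_term c h (fun i => a i : nat)|) +
        limn (fun N : nat => \sum_(a : {ffun 'I_m -> 'I_N})
          `|power_series_term c' h (fun i => a i : nat)|)) => _ [N _ <-].
apply: (@le_trans _ _ (\sum_(a : {ffun 'I_m -> 'I_N})
  (`|power_series_term c h (fun i => a i : nat)| +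
   `|power_series_term c' h (fun i => a i : nat)|))).
  by apply: ler_sum => a _; exact: ler_normD.
rewrite big_split /=; apply: lerD.
  exact: (nondecreasing_cvgn_le (nd c) H1).
exact: (nondecreasing_cvgn_le (nd c') H3).
Qed.

End TwoVariables.

Lemma square_sum_inverse (K : fieldType) (z0 d z S B : K) :
  z0 != 0 -> d != 0 -> S * d = 1 - B -> z0 * d = z -> z0^-1 * S = z^-1 - B / z.
Proof.
move=> z00 d0 Sd <-; have -> : S = (1 - B) / d by rewrite -Sd mulfK.
by field; rewrite d0 z00.
Qed.

Section ComplexCoordinates.
Variables (R : realType).
Local Notation C := R[i].
Local Notation normc := (@ComplexField.Normc.normc R).

Lemma cvg_eventually_cst (u : R^nat) (l : R) :
  (forall N, u N.+2 = l) -> u @ \oo --> l.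
Proof.
move=> ul; rewrite -(@cvg_shiftS _ u) -(@cvg_shiftS _ (fun N => u N.+1)).
by under eq_fun do rewrite ul; exact: cvg_cst.
Qed.

Section InverseSeries.
(** Both the real part and the imaginary part are such a [phi]. *)
Variable phi : C -> R.
Hypotheses (phiD : forall z1 z2, phi (z1 + z2) = phi z1 + phi z2)
  (phiZ : forall z (r : R), phi (z * r%:C) = phi z * r)
  (phi_le : forall z, `|phi z| <= normc z).

Let phi0 : phi 0 = 0.
Proof.
rewrite -[0 in LHS](mulr0 (0 : C)) -[0 in X in _ * X](rmorph0 (real_complex R)).
by rewrite phiZ mulr0.
Qed.

Let phi_sum (I : finType) (f : I -> C) : phi (\sum_i f i) = \sum_i phi (f i).
Proof. exact: (big_morph phi phiD phi0). Qed.

Definition inverse_coef (z0 : C) (p q : nat) :=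
  phi (z0^-1 * binomial_term (- z0^-1) (- ('i / z0)) p q).

(** [1 / (z0 + h + i k)] is [z0^-1 / (1 - a - b)] for [a = - h / z0] and
    [b = - i k / z0]. The bounds on [h] and [k] make the sum of the moduli of [a]
    and [b] less than 1, so that the real expansion of [1 / (1 - |a| - |b|)]
    dominates both the terms of the series and its error. *)
Lemma inverse_series (z0 : C) (h k : R) : z0 != 0 ->
  `|h| < normc z0 / 2 -> `|k| < normc z0 / 2 ->
  cvgn (fun N => \sum_(p < N) \sum_(q < N)
     `|inverse_coef z0 p q * (h ^+ p * k ^+ q)|) /\
  (fun N => \sum_(p < N) \sum_(q < N) inverse_coef z0 p q * (h ^+ p * k ^+ q))
    @ \oo --> phi ((z0 + (h +i* k))^-1).
Proof.
move=> z00 hz kz; have nz0 := normc_gt0 z00.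
pose a := - z0^-1 * h%:C; pose b := - ('i / z0) * k%:C.
have termE p q : inverse_coef z0 p q * (h ^+ p * k ^+ q) =
    phi (z0^-1 * binomial_term a b p q).
  rewrite /inverse_coef -phiZ; congr phi.
  by rewrite -mulrA binomial_termM rmorphM !rmorphXn.
have na : normc a = `|h| / normc z0.
  rewrite ComplexField.Normc.normcM normcN ComplexField.Normc.normcV normc_real.
  by rewrite mulrC.
have nb : normc b = `|k| / normc z0.
  rewrite ComplexField.Normc.normcM normcN ComplexField.Normc.normcM.
  by rewrite ComplexField.Normc.normcV normc_real normc_i mul1r mulrC.
have nab : normc a + normc b < 1.
  rewrite na nb -mulrDl ltr_pdivrMr // mul1r [ltRHS]splitr.
  exact: ltrD.
have d0 : 1 - a - b != 0.
  rewrite -addrA -opprD subr_eq0; apply: contraTneq nab => E.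
  rewrite -leNgt; apply: le_trans (le_normcD _ _); rewrite -E.
  by rewrite -[leLHS](@ComplexField.Normc.normc1 R).
have zE : z0 * (1 - a - b) = z0 + (h +i* k).
  rewrite /a /b !mulNr !opprK !mulrDr mulr1 -addrA; congr (_ + _).
  rewrite mulVKf // mulrCA mulrA divfK // [RHS]complexE /=.
  by rewrite mulrC.
move: zE; set z := z0 + (h +i* k) => zE.
have z_neq0 : z != 0 by rewrite -zE mulf_neq0.
have nz := normc_gt0 z_neq0.
have SE N : z0^-1 * square_sum a b N.+1 = z^-1 - square_boundary a b N / z.
  exact: (square_sum_inverse z00 d0 (square_sum_pascal a b N) zE).
split.
  apply: nondecreasing_is_cvgn; first exact: (sum_square_nondecreasing
    (g := fun p q => `|inverse_coef z0 p q * (h ^+ p * k ^+ q)|)).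
  exists ((normc z0)^-1 * (1 - normc a - normc b)^-1) => _ [N _ <-].
  apply: (@le_trans _ _ ((normc z0)^-1 * square_sum (normc a) (normc b) N)).
    rewrite mulr_sumr; apply: ler_sum => p _.
    rewrite mulr_sumr; apply: ler_sum => q _.
    rewrite termE; apply: le_trans (phi_le _) _.
    rewrite ComplexField.Normc.normcM ComplexField.Normc.normcV.
    by rewrite normc_binomial_term.
  rewrite ler_wpM2l ?invr_ge0 ?normc_ge0 //.
  by apply: square_sum_ge; rewrite ?normc_ge0.
rewrite -cvg_shiftS /=.
have -> : (fun N : nat => \sum_(p < N.+1) \sum_(q < N.+1)
     inverse_coef z0 p q * (h ^+ p * k ^+ q)) =
   (fun N => phi z^-1 - phi (square_boundary a b N / z)).
  apply/funext => N.
  have -> : phi z^-1 - phi (square_boundary a b N / z) =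
     phi (z^-1 - square_boundary a b N / z).
    by apply/eqP; rewrite subr_eq -phiD subrK.
  rewrite -SE /square_sum mulr_sumr phi_sum; apply: eq_bigr => p _.
  by rewrite mulr_sumr phi_sum; apply: eq_bigr => q _.
rewrite -[phi z^-1 in X in _ --> X]subr0; apply: cvgB; first exact: cvg_cst.
have bd0 : (fun N => square_boundary (normc a) (normc b) N / normc z)
    @ \oo --> (0 : R).
  rewrite -[0 in X in _ --> X](mul0r (normc z)^-1); apply: cvgMl.
  by apply: square_boundary_cvg0; rewrite ?normc_ge0.
apply: (@squeeze_cvgr _ _ _ _
  (fun N => - (square_boundary (normc a) (normc b) N / normc z))
  (fun N => square_boundary (normc a) (normc b) N / normc z)) => //.
  near=> N; rewrite -ler_norml; apply: le_trans (phi_le _) _.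
  rewrite ComplexField.Normc.normcM ComplexField.Normc.normcV.
  by rewrite ler_pM2r ?invr_gt0 // normc_square_boundary.
by rewrite -[0 in X in _ --> X]oppr0; exact: cvgN.
Unshelve. all: by end_near.
Qed.

End InverseSeries.

End ComplexCoordinates.

Section AnalyticComplexFunctions.
Variables (R : realType) (m : nat).
Local Notation C := R[i].
Local Notation normc := (@ComplexField.Normc.normc R).
Implicit Types (F G : 'rV[R]_m -> C) (x y : 'rV[R]_m).

(** The expansion [y_i = x_i + h], seen as a double series in [h] and in the
    increment of an auxiliary coordinate [j]. *)
Lemma real_analytic_coord (i j : 'I_m) x : i != j ->
  real_analytic_at (fun y => y 0 i) x.
Proof.
move=> ij.
pose c p q : R := ((p + q == 0)%N)%:R * x 0 i + ((p == 1) && (q == 0))%N%:R.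
apply: (@real_analytic_two_variables _ _ _ _ i j c (fun h _ => h) 1) => //.
move=> h k _ _.
have sumE (g : R -> R) N : g 0 = 0 ->
    \sum_(p < N.+2) \sum_(q < N.+2) g (c p q * (h ^+ p * k ^+ q)) =
    g (x 0 i) + g h.
  move=> g0; have c0 p q : (1 < p + q)%N || (q == 1)%N -> c p q = 0.
    by rewrite /c; case: p q => [|[|p]] [|[|q]] //= _; rewrite mul0r addr0.
  rewrite 2!big_ord_recl [X in _ + (_ + X)]big1 => [|p _]; last first.
    by rewrite big1 // => q _; rewrite c0 ?mul0r.
  rewrite addr0; congr (_ + _); rewrite big_ord_recl big1 ?addr0.
  - by rewrite /c /= !expr0 !mulr1 mul1r addr0.
  - by move=> q _; rewrite c0 ?mul0r //; case: q => [[|q]].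
  - by rewrite /c /= !expr0 mul0r add0r mul1r mulr1 expr1.
  - by move=> q _; rewrite c0 ?mul0r.
split.
  apply/cvg_ex; exists (`|x 0 i| + `|h|); apply: cvg_eventually_cst => N.
  by rewrite (sumE (fun r => `|r|)) ?normr0.
by apply: cvg_eventually_cst => N; rewrite (sumE id).
Qed.

(** Continuity is carried along with analyticity, to be used when open sets are
    pulled back by coordinate changes. *)
Definition analytic_pair F x :=
  [/\ real_analytic_at (fun y => complex.Re (F y)) x,
      real_analytic_at (fun y => complex.Im (F y)) x,
      (fun y => complex.Re (F y)) @ x --> complex.Re (F x) &
      (fun y => complex.Im (F y)) @ x --> complex.Im (F x)].

Definition pair_coord (i j : 'I_m) (y : 'rV[R]_m) : C := y 0 i +i* y 0 j.

Lemma analytic_pair_coord (i j : 'I_m) x :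
  i != j -> analytic_pair (pair_coord i j) x.
Proof.
move=> ij; split => /=; try exact: coord_continuous.
- exact: real_analytic_coord ij.
- by apply: (@real_analytic_coord j i); rewrite eq_sym.
Qed.

Lemma analytic_pair_inverse (i j : 'I_m) x : i != j -> pair_coord i j x != 0 ->
  analytic_pair (fun y => (pair_coord i j y)^-1) x.
Proof.
have FF : Filter (nbhs x) by exact: nbhs_filter.
move=> ij z0; have nz := normc_gt0 z0.
have e0 : 0 < normc (pair_coord i j x) / 2 by rewrite divr_gt0.
have ana phi : (forall z1 z2 : C, phi (z1 + z2) = phi z1 + phi z2) ->
    (forall (z : C) (r : R), phi (z * r%:C) = phi z * r) ->
    (forall z, `|phi z| <= normc z) ->
    real_analytic_at (fun y => phi (pair_coord i j y)^-1) x.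
  move=> phiD phiZ phi_le.
  apply: (@real_analytic_two_variables _ _ _ _ i j
    (inverse_coef phi (pair_coord i j x))
    (fun h k => phi (h +i* k)^-1) _ ij e0) => // h k he ke.
  exact: (inverse_series phiD phiZ phi_le z0 he ke).
have n0 : x 0 i ^+ 2 + x 0 j ^+ 2 != 0.
  apply: contra z0; rewrite paddr_eq0 ?sqr_ge0 // !sqrf_eq0.
  move=> /andP[/eqP xi /eqP xj].
  by rewrite /pair_coord xi xj.
have cn : (fun y : 'rV[R]_m => y 0 i ^+ 2 + y 0 j ^+ 2) @ x -->
    x 0 i ^+ 2 + x 0 j ^+ 2.
  have -> : (fun y : 'rV[R]_m => y 0 i ^+ 2 + y 0 j ^+ 2) =
     (fun y => y 0 i * y 0 i + y 0 j * y 0 j) by [].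
  by rewrite !expr2; apply: cvgD; apply: cvgM; exact: coord_continuous.
split.
- apply: (ana (@complex.Re R)); first by move=> [? ?] [? ?].
  + by move=> [u v] r /=; rewrite mulr0 subr0.
  + exact: Re_le_normc.
- apply: (ana (@complex.Im R)); first by move=> [? ?] [? ?].
  + by move=> [u v] r /=; rewrite mulr0 add0r.
  + exact: Im_le_normc.
- apply: cvgM; first exact: coord_continuous.
  exact: cvgV.
- apply: cvgN; apply: cvgM; first exact: coord_continuous.
  exact: cvgV.
Qed.

Lemma analytic_pairN F x : analytic_pair F x -> analytic_pair (fun y => - F y) x.
Proof.
have E1 (z : C) : complex.Re (- z) = - complex.Re z by case: z.
have E2 (z : C) : complex.Im (- z) = - complex.Im z by case: z.
have F1 : (fun y => complex.Re (- F y)) = (fun y => - complex.Re (F y)).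
  exact/funext.
have F2 : (fun y => complex.Im (- F y)) = (fun y => - complex.Im (F y)).
  exact/funext.
have FF : Filter (nbhs x) by exact: nbhs_filter.
move=> [H1 H2 H3 H4]; split; rewrite ?F1 ?F2 ?E1 ?E2.
- exact: real_analyticN.
- exact: real_analyticN.
- exact: cvgN.
- exact: cvgN.
Qed.

Lemma analytic_pairD F G x : analytic_pair F x -> analytic_pair G x ->
  analytic_pair (fun y => F y + G y) x.
Proof.
have E1 (z w : C) : complex.Re (z + w) = complex.Re z + complex.Re w.
  by case: z w => ? ? [].
have E2 (z w : C) : complex.Im (z + w) = complex.Im z + complex.Im w.
  by case: z w => ? ? [].
have F1 : (fun y => complex.Re (F y + G y)) =
  (fun y => complex.Re (F y) + complex.Re (G y)) by apply/funext.
have F2 : (fun y => complex.Im (F y + G y)) =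
  (fun y => complex.Im (F y) + complex.Im (G y)) by apply/funext.
have FF : Filter (nbhs x) by exact: nbhs_filter.
move=> [H1 H2 H3 H4] [G1 G2 G3 G4]; split; rewrite ?F1 ?F2 ?E1 ?E2.
- exact: real_analyticD.
- exact: real_analyticD.
- exact: cvgD.
- exact: cvgD.
Qed.

Lemma analytic_pair0 x : analytic_pair (fun=> 0) x.
Proof.
have FF : Filter (nbhs x) by exact: nbhs_filter.
split; try exact: real_analytic0; exact: cvg_cst.
Qed.

Lemma analytic_pair_sum (I : finType) (F : I -> 'rV[R]_m -> C) x :
  (forall i, analytic_pair (F i) x) -> analytic_pair (fun y => \sum_i F i y) x.
Proof.
move=> H; elim: (index_enum I) => [|i r IH].
  under eq_fun do rewrite big_nil; exact: analytic_pair0.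
under eq_fun do rewrite big_cons; exact: analytic_pairD.
Qed.

End AnalyticComplexFunctions.

(** * Coordinates on configurations *)
Section Coordinates.
Variables (R : realType) (s : nat).
Local Notation C := R[i].
Local Notation n := (s.-1 + s)%N.
Local Notation m := (n + n)%N.
Implicit Types (x : config R s) (y : 'rV[R]_m) (b : 'I_s -> bool) (rho : 'S_m).

(** The coordinates of a chart of configurations, with their order changed by
    [rho], so that one family of maps contains both the charts of the atlas
    ([rho = 1]) and the adapted ones, in which the real parts of the residues
    come last. *)
Definition coords b rho x : 'rV[R]_m :=
  \row_j realify (chart_map (config_chart R b) x) 0 (rho j).

(** The complex number that [coords] has split into real and imaginary parts,
    see [zcoord_coords]. *)
Definition zcoord rho (k : 'I_n) : 'rV[R]_m -> C :=
  pair_coord ((rho^-1)%g (lshift n k)) ((rho^-1)%g (rshift n k)).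

Lemma realify_Re p (v : 'rV[C]_p) k :
  realify v 0 (lshift p k) = complex.Re (v 0 k).
Proof. by rewrite /realify row_mxEl mxE. Qed.

Lemma realify_Im p (v : 'rV[C]_p) k :
  realify v 0 (rshift p k) = complex.Im (v 0 k).
Proof. by rewrite /realify row_mxEr mxE. Qed.

Lemma zcoord_coords b rho x k :
  zcoord rho k (coords b rho x) = chart_map (config_chart R b) x 0 k.
Proof.
rewrite /zcoord /pair_coord; set z := (RHS).
have cE j : coords b rho x 0 j =
    realify (chart_map (config_chart R b) x) 0 (rho j).
  by rewrite mxE.
by rewrite !cE !permKV realify_Re realify_Im -/z; case: z.
Qed.

Lemma coords_eq b rho x y :
  (forall k, zcoord rho k y = chart_map (config_chart R b) x 0 k) ->
  coords b rho x = y.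
Proof.
move=> xy; apply/rowP => j; rewrite mxE -[in RHS](permK rho j).
by case: (split_ordP (rho j)) => k ->; rewrite ?realify_Re ?realify_Im -xy.
Qed.

Lemma pair_indices_neq rho k :
  (rho^-1)%g (lshift n k) != (rho^-1)%g (rshift n k).
Proof. by rewrite (inj_eq perm_inj) eq_lrshift. Qed.

Lemma analytic_zcoord rho k y : analytic_pair (zcoord rho k) y.
Proof. exact/analytic_pair_coord/pair_indices_neq. Qed.

Lemma analytic_zcoord_inverse rho k y : zcoord rho k y != 0 ->
  analytic_pair (fun y => (zcoord rho k y)^-1) y.
Proof. exact/analytic_pair_inverse/pair_indices_neq. Qed.

Definition sphere_point (at_infinity : bool) (z : C) : sphere R :=
  if at_infinity then if z == 0 then None else Some z^-1 else Some z.

Lemma sphere_point_dom c z : chart_dom (sphere_chart R c) (sphere_point c z).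
Proof.
case: c => //=; case: eqVneq => // z0 [] /eqP.
by rewrite invr_eq0 (negPf z0).
Qed.

Lemma sphere_chartK c p : chart_dom (sphere_chart R c) p ->
  sphere_point c (chart_map (sphere_chart R c) p) = p.
Proof.
case: c p => -[z|] //=; last by rewrite eqxx.
by rewrite invr_eq0 invrK; case: eqVneq => [->|].
Qed.

(** As [0^-1 = 0], the change of coordinate on the sphere is [z |-> z^-1] with no
    exception at the origin. *)
Lemma sphere_chart_change c c' z :
  chart_map (sphere_chart R c') (sphere_point c z) = if c == c' then z else z^-1.
Proof.
by case: c c' => -[] //=; case: eqVneq => [->|]; rewrite ?invrK ?invr0.
Qed.

Lemma sphere_point_change_dom c c' z :
  chart_dom (sphere_chart R c') (sphere_point c z) <-> (c == c') || (z != 0).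
Proof.
split.
  case: eqVneq => [//|cc']; apply: contraPneq => ->.
  by case: c c' cc' => -[] //= _; rewrite ?eqxx; apply.
case: eqVneq => [<- _|_ /= z0]; first exact: sphere_point_dom.
case: c c' => -[] //=; rewrite ?(negPf z0) //.
  by move=> [/eqP]; rewrite invr_eq0 (negPf z0).
by move=> [/eqP]; rewrite (negPf z0).
Qed.

(** The last residue is not a coordinate: it is minus the sum of the others. *)
Definition residue_coord rho y (i : 'I_s) : C :=
  if insub (i : nat) : option 'I_s.-1 is Some k then zcoord rho (lshift s k) y
  else - \sum_(k < s.-1) zcoord rho (lshift s k) y.

Definition config_of b rho y : config R s :=
  (residue_coord rho y,
   fun i => sphere_point (b i) (zcoord rho (rshift s.-1 i) y)).

Lemma sum_last_ord (V : nmodType) (F : 'I_s -> V) (l : 'I_s) :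
  l = s.-1 :> nat ->
  \sum_i F i = \sum_(k < s.-1) F (widen_ord (leq_pred s) k) + F l.
Proof.
move: F l (leq_pred s); case: s => [|t] F l le_t ll; first by case: l ll.
rewrite big_ord_recr /=; congr (_ + F _); last exact: val_inj.
by apply: eq_bigr => k _; congr F; exact: val_inj.
Qed.

Lemma residue_coord_widen rho y k :
  residue_coord rho y (widen_ord (leq_pred s) k) = zcoord rho (lshift s k) y.
Proof. by rewrite /residue_coord /= valK. Qed.

Lemma residue_coord_last rho y (l : 'I_s) : l = s.-1 :> nat ->
  residue_coord rho y l = - \sum_(k < s.-1) zcoord rho (lshift s k) y.
Proof. by move=> ll; rewrite /residue_coord insubF // ll ltnn. Qed.

Lemma ord_lastP (i : 'I_s) :
  i = s.-1 :> nat \/ exists k, i = widen_ord (leq_pred s) k.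
Proof.
have [lt_i|ge_i] := ltnP i s.-1.
  by right; exists (Ordinal lt_i); exact: val_inj.
left; apply/eqP; rewrite eqn_leq ge_i andbT.
by have := ltn_ord i; lia.
Qed.

Lemma residue_coord_sum rho y : \sum_i residue_coord rho y i = 0.
Proof.
have [s0|s0] := posnP s.
  rewrite big1 // => i; have := leq_ltn_trans (leq0n i) (ltn_ord i).
  by rewrite [X in (0 < X)%N]s0.
have ll : (s.-1 < s)%N by rewrite prednK.
rewrite (@sum_last_ord _ _ (Ordinal ll)) // residue_coord_last //.
rewrite (eq_bigr _ (fun k _ => residue_coord_widen rho y k)) subrr //.
Qed.

Lemma config_ofK b rho x : chart_dom (config_chart R b) x ->
  config_of b rho (coords b rho x) = x.
Proof.
move=> [[_ x0 _] xb]; rewrite [RHS]surjective_pairing; congr pair.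
  apply/funext => i; have zE k : zcoord rho (lshift s k) (coords b rho x) =
      x.1 (widen_ord (leq_pred s) k).
    by rewrite zcoord_coords /= row_mxEl mxE.
  have [il|[k ->]] := ord_lastP i; last by rewrite residue_coord_widen zE.
  rewrite residue_coord_last // (eq_bigr _ (fun k _ => zE k)).
  by apply/eqP; rewrite eq_sym -addr_eq0 addrC -sum_last_ord // x0.
apply/funext => i; rewrite zcoord_coords /= row_mxEr mxE.
exact/sphere_chartK/xb.
Qed.

Lemma coordsK b rho y : coords b rho (config_of b rho y) = y.
Proof.
apply: coords_eq => k; case: (split_ordP k) => j -> /=.
  by rewrite row_mxEl mxE residue_coord_widen.
by rewrite row_mxEr mxE /= sphere_chart_change eqxx.
Qed.

Lemma analytic_residue_coord rho i y :
  analytic_pair (fun y => residue_coord rho y i) y.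
Proof.
rewrite /residue_coord; case: insub => [k|]; first exact: analytic_zcoord.
by apply/analytic_pairN/analytic_pair_sum => k; exact: analytic_zcoord.
Qed.

Definition permute (sigma : 'S_s) x : config R s :=
  (x.1 \o sigma, x.2 \o sigma).

(** Renumbering the poles and changing charts replaces each complex coordinate
    by another one, by minus a sum of coordinates, or by the inverse of one, which
    is then nonzero because both charts of the sphere contain the point. *)
Lemma analytic_change b b' rho (sigma : 'S_s) y k :
  (forall i, chart_dom (sphere_chart R (b' i))
     ((permute sigma (config_of b rho y)).2 i)) ->
  analytic_pair (fun y => chart_map (config_chart R b')
    (permute sigma (config_of b rho y)) 0 k) y.
Proof.
move=> dom; case: (split_ordP k) => i -> /=.
  under eq_fun do rewrite row_mxEl mxE /=; exact: analytic_residue_coord.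
under eq_fun do rewrite row_mxEr mxE /= sphere_chart_change.
have := dom i; rewrite /= sphere_point_change_dom.
case: eqVneq => [_ _|_ /= z0].
  exact: analytic_zcoord.
exact: analytic_zcoord_inverse.
Qed.

End Coordinates.

(** * Transition maps between charts of forms *)
Section RowTopology.
Variables (R : realType) (m : nat).
Local Notation C := R[i].
Implicit Types (x y h : 'rV[R]_m).

Lemma nbhs_row_filter x : Filter (nbhs x).
Proof. exact: nbhs_filter. Qed.

Lemma nbhs_row_box x (U : set 'rV[R]_m) : nbhs x U ->
  exists2 e, 0 < e & forall h, (forall i, `|h 0 i| < e) -> U (x + h).
Proof.
move=> /nbhs_ballP[e e0 eU]; exists e => // h he; apply: eU; split => // i j.
rewrite /ball /= mxE ord1 opprD addNKr normrN; exact: he.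
Qed.

Lemma near_row p x (f : 'rV[R]_m -> 'rV[R]_p) (U : set 'rV[R]_p) :
  (forall j, (fun y => f y 0 j) @ x --> f x 0 j) -> nbhs (f x) U ->
  \forall y \near x, U (f y).
Proof.
move=> fx [P xP PU]; have FF := nbhs_row_filter x.
have : \forall y \near x, forall j, P 0 j (f y 0 j).
  apply: (@filter_forall _ _ (fun j y => P 0 j (f y 0 j)) _ FF) => j.
  exact: (fx j _ (xP 0 j)).
by apply: filterS => y Py; apply: PU => i j; rewrite ord1.
Qed.

Lemma real_analytic_near f g x : (\forall y \near x, f y = g y) ->
  real_analytic_at f x -> real_analytic_at g x.
Proof.
move=> /nbhs_row_box[e' e'0 fg] [c [e [e0 H]]].
exists c, (Num.min e e'); split; first by rewrite lt_min e0.
move=> h he; rewrite -fg => [|i]; last first.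
  by have := he i; rewrite lt_min => /andP[].
by apply: H => i; have := he i; rewrite lt_min => /andP[].
Qed.

Lemma analytic_pair_near0 (F : 'rV[R]_m -> C) x :
  analytic_pair F x -> F x != 0 ->
  \forall y \near x, F y != 0.
Proof.
move=> [_ _ cR cI] F0; have FF := nbhs_row_filter x.
have [R0|R0] := eqVneq (complex.Re (F x)) 0; last first.
  have : \forall y \near x, complex.Re (F y) != 0 by exact: (cvgr_neq0 _ cR).
  by apply: filterS => y; apply: contra => /eqP ->.
have I0 : complex.Im (F x) != 0.
  by apply: contra F0; rewrite eq_complex R0 eqxx.
have : \forall y \near x, complex.Im (F y) != 0 by exact: (cvgr_neq0 _ cI).
by apply: filterS => y; apply: contra => /eqP ->.
Qed.

End RowTopology.

Section Transitions.
Variables (R : realType) (s : nat).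
Local Notation C := R[i].
Local Notation n := (s.-1 + s)%N.
Local Notation m := (n + n)%N.
Implicit Types (x : config R s) (y : 'rV[R]_m) (b : 'I_s -> bool) (rho : 'S_m).
Implicit Types (alpha : chart (ratfun R) 'rV[R]_m) (V : set (config R s)).

(** The charts of the space of forms that are given by coordinates [coords b rho]
    on a set [V] of numbered configurations. *)
Definition residue_chart b rho V alpha :=
  [/\ V `<=` chart_dom (config_chart R b), set_inj V (@config_class R s),
      open (coords b rho @` V), chart_dom alpha = @form_of R s @` V &
      forall x, V x -> chart_map alpha (form_of x) = coords b rho x].

Lemma form_of_inj x x' : configs x -> configs x' -> form_of x = form_of x' ->
  exists sigma : 'S_s, x' = permute sigma x.
Proof.
move=> cx cx' E; apply/config_class_eqP.
by rewrite -!residue_class_form_of // E.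
Qed.

Lemma form_of_permute x (sigma : 'S_s) : form_of (permute sigma x) = form_of x.
Proof. by apply/form_of_class/esym/config_class_eqP; exists sigma. Qed.

Definition transition b b' rho rho' (sigma : 'S_s) y : 'rV[R]_m :=
  coords b' rho' (permute sigma (config_of b rho y)).

Lemma analytic_transition_coord b b' rho rho' (sigma : 'S_s) y j :
  (forall i, chart_dom (sphere_chart R (b' i))
     ((permute sigma (config_of b rho y)).2 i)) ->
  let f := fun y => transition b b' rho rho' sigma y 0 j in
  real_analytic_at f y /\ f @ y --> f y.
Proof.
move=> dom f.
pose z k y' :=
  chart_map (config_chart R b') (permute sigma (config_of b rho y')) 0 k.
have zP k : analytic_pair (z k) y := analytic_change k dom.
case: (split_ordP (rho' j)) => k jk; have [aR aI cR cI] := zP k.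
  have fE y' : f y' = complex.Re (z k y') by rewrite /f mxE jk realify_Re.
  by rewrite fE (funext fE).
have fE y' : f y' = complex.Im (z k y') by rewrite /f mxE jk realify_Im.
by rewrite fE (funext fE).
Qed.

(** The renumbering is locally constant on an overlap, because a transition map
    with a fixed [sigma] is continuous and the coordinates of [V'] range over an
    open set. *)
Lemma near_overlap b b' rho rho' V V' (sigma : 'S_s) x :
  V `<=` chart_dom (config_chart R b) ->
  V' `<=` chart_dom (config_chart R b') ->
  open (coords b rho @` V) -> open (coords b' rho' @` V') ->
  V x -> V' (permute sigma x) ->
  \forall y \near coords b rho x,
    V (config_of b rho y) /\ V' (permute sigma (config_of b rho y)).
Proof.
move=> Vb V'b' oV oV' Vx V'x; set y0 := coords b rho x.
have FF := nbhs_row_filter y0.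
have xE : config_of b rho y0 = x by apply/config_ofK/Vb.
have dom0 i : chart_dom (sphere_chart R (b' i))
    ((permute sigma (config_of b rho y0)).2 i).
  by rewrite xE; have [_] := V'b' _ V'x; exact.
have near1 : \forall y \near y0, (coords b rho @` V) y.
  by apply: open_nbhs_nbhs; split => //; exists x.
have near2 : \forall y \near y0,
    (coords b' rho' @` V') (transition b b' rho rho' sigma y).
  apply: near_row => [j|].
    by have [] := analytic_transition_coord rho' j dom0.
  apply: open_nbhs_nbhs; split => //; rewrite /transition xE.
  by exists (permute sigma x).
have near3 : \forall y \near y0, forall i, chart_dom (sphere_chart R (b' i))
    ((permute sigma (config_of b rho y)).2 i).
  apply: (@filter_forall _ _ (fun i y =>
    chart_dom (sphere_chart R (b' i))
      ((permute sigma (config_of b rho y)).2 i)) _ FF) => i.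
  have := dom0 i.
  rewrite /= sphere_point_change_dom => /orP[bb|z0].
    by apply: filterE => y; rewrite sphere_point_change_dom bb.
  have := analytic_pair_near0 (analytic_zcoord _ _ _) z0.
  by apply: filterS => y zy; rewrite sphere_point_change_dom zy orbT.
apply: filterS3 near1 near2 near3 => y [x1 Vx1 <-].
rewrite /transition config_ofK; last exact: Vb.
move=> [x2 V'x2 E] dom; split => //.
suff <- : x2 = permute sigma x1 by [].
rewrite -(config_ofK rho' (V'b' _ V'x2)) E config_ofK //; split => //.
by apply: configs_perm; have [] := Vb _ Vx1.
Qed.

(** By [near_overlap] the transition map coincides near each point with one of
    the maps [transition], whose coordinates are analytic. *)
Lemma residue_chart_transition b b' rho rho' V V' alpha alpha' :
  residue_chart b rho V alpha -> residue_chart b' rho' V' alpha' ->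
  analytic_transition alpha alpha'.
Proof.
move=> [Vb Vi oV da ma] [Vb' Vi' oV' da' ma'].
pose D := chart_dom alpha `&` chart_dom alpha'.
have DP f : D f -> exists x (sigma : 'S_s),
    [/\ V x, V' (permute sigma x), f = form_of x &
        chart_map alpha f = coords b rho x].
  rewrite /D da da' => -[[x Vx <-] [x' Vx' E]].
  have [sigma Es] : exists sigma, x' = permute sigma x.
    apply: form_of_inj => //; first by have [] := Vb _ Vx.
    by have [] := Vb' _ Vx'.
  by exists x, sigma; split => //; rewrite -?Es // ma.
have PD x (sigma : 'S_s) : V x -> V' (permute sigma x) -> D (form_of x).
  move=> Vx V'x; split; first by rewrite da; exists x.
  by rewrite da'; exists (permute sigma x) => //; rewrite form_of_permute.
split.
  rewrite openE => _ [f /DP[x [sigma [Vx V'x -> ->]]] <-].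
  have := near_overlap Vb Vb' oV oV' Vx V'x.
  apply: filterS => y [Vy V'y]; exists (form_of (config_of b rho y)).
    exact: PD Vy V'y.
  by rewrite ma // coordsK.
exists (fun y => chart_map alpha' (form_of (config_of b rho y))).
  move=> f /set_mem/DP[x [sigma [Vx V'x -> ->]]].
  by rewrite config_ofK //; exact: Vb.
move=> _ [f /DP[x [sigma [Vx V'x -> ->]]] <-] j.
have dom0 i : chart_dom (sphere_chart R (b' i))
    ((permute sigma (config_of b rho (coords b rho x))).2 i).
  rewrite config_ofK; last exact: Vb.
  by have [_] := Vb' _ V'x; exact.
have [ana _] := analytic_transition_coord rho' j dom0.
apply: real_analytic_near ana.
have := near_overlap Vb Vb' oV oV' Vx V'x.
apply: filterS => y [Vy V'y].
by rewrite -(form_of_permute _ sigma) ma'.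
Qed.

End Transitions.

(** * Disjoint neighbourhoods of the poles *)
Section Cells.
Variables (R : realType).
Local Notation C := R[i].

Definition normsq (z : C) : R := complex.Re z ^+ 2 + complex.Im z ^+ 2.

Lemma normsqM (z w : C) : normsq (z * w) = normsq z * normsq w.
Proof. by case: z w => a b [c d]; rewrite /normsq /=; ring. Qed.

Lemma normsq_gt0 (z : C) : (0 < normsq z) = (z != 0).
Proof.
case: z => a b; rewrite /normsq lt0r addr_ge0 ?sqr_ge0 // andbT.
by rewrite paddr_eq0 ?sqr_ge0 // !sqrf_eq0 eq_complex.
Qed.

Lemma normsq0 : normsq 0 = 0.
Proof. by rewrite /normsq /= expr0n addr0. Qed.

(** Write the points of the sphere as vectors [(z, 1)] and [(1, 0)]; this is the
    squared modulus of the determinant of [p] and [a]. Rescaling [p] multiplies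
    it by a factor that does not depend on [a], so that the condition
    [sphere_gap p a < sphere_gap p b] may be read in either chart. *)
Definition sphere_gap (p a : sphere R) : R :=
  match p, a with
  | Some z, Some w => normsq (z - w)
  | None, None => 0
  | _, _ => 1
  end.

Lemma sphere_gap_self p : sphere_gap p p = 0.
Proof. by case: p => [z|] //=; rewrite subrr normsq0. Qed.

Lemma sphere_gap_gt0 p a : p <> a -> 0 < sphere_gap p a.
Proof.
case: p a => [z|] [w|] //= pa; rewrite ?ltr01 // normsq_gt0 subr_eq0.
by apply/eqP => zw; apply: pa; rewrite zw.
Qed.

(** In the chart at infinity, [p] is the vector [(1, z)]. *)
Lemma sphere_gap_infinity (z w : C) :
  (sphere_gap (sphere_point true z) None <
   sphere_gap (sphere_point true z) (Some w)) =
  (normsq z < normsq (- w * z + 1)).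
Proof.
rewrite /=; case: (eqVneq z 0) => [->|z0] /=.
  by rewrite mulr0 add0r normsq0 normsq_gt0 oner_neq0 ltr01.
have -> : - w * z + 1 = (z^-1 - w) * z by rewrite mulrBl mulVf // mulNr addrC.
by rewrite normsqM ltr_pMl // normsq_gt0.
Qed.

Variable m : nat.
Implicit Types (F : 'rV[R]_m -> C) (y : 'rV[R]_m).

Lemma cvg_normsq_affine F y (c d : C) : analytic_pair F y ->
  (fun y => normsq (c * F y + d)) @ y --> normsq (c * F y + d).
Proof.
move=> [_ _ cR cI]; have FF := nbhs_row_filter y.
pose u z :=
  complex.Re c * complex.Re z - complex.Im c * complex.Im z + complex.Re d.
pose v z :=
  complex.Re c * complex.Im z + complex.Im c * complex.Re z + complex.Im d.
have E z : normsq (c * z + d) = u z * u z + v z * v z.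
  by case: c d z @u @v => [c1 c2] [d1 d2] [z1 z2]; rewrite /normsq /= -!expr2.
under eq_fun do rewrite E; rewrite E.
have cst (k : R) : (fun _ : 'rV[R]_m => k) @ y --> k by exact: cvg_cst.
have cu : (fun y => u (F y)) @ y --> u (F y).
  by apply: cvgD => //; apply: cvgB; exact: cvgM.
have cv : (fun y => v (F y)) @ y --> v (F y).
  by apply: cvgD => //; apply: cvgD; exact: cvgM.
by apply: cvgD; apply: cvgM.
Qed.

Lemma near_lt (f g : 'rV[R]_m -> R) y : f @ y --> f y -> g @ y --> g y ->
  f y < g y -> \forall z \near y, f z < g z.
Proof.
move=> fy gy lt; have FF := nbhs_row_filter y.
have H : (fun z => g z - f z) @ y --> g y - f y by exact: cvgB.
have lt0 : 0 < g y - f y by rewrite subr_gt0.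
by apply: filterS (cvgr_gt _ H _ lt0) => z; rewrite subr_gt0.
Qed.

(** [F] is the coordinate of [q] in the chart centred at infinity if [a] is
    infinity, and in the finite chart otherwise; in both cases the inequality is
    one between continuous functions of [F]. *)
Lemma sphere_gap_near (a a' : sphere R) F y : analytic_pair F y ->
  let q y := sphere_point (~~ isSome a) (F y) in
  sphere_gap (q y) a < sphere_gap (q y) a' ->
  \forall z \near y, sphere_gap (q z) a < sphere_gap (q z) a'.
Proof.
move=> Fy q; have FF := nbhs_row_filter y; rewrite /q {q}.
have affine c d := cvg_normsq_affine (c := c) (d := d) Fy.
have cst : (fun _ : 'rV[R]_m => 1 : R) @ y --> (1 : R) by exact: cvg_cst.
have E1 w z : normsq (F z - w) = normsq (1 * F z + - w) by rewrite mul1r.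
have E0 z : normsq (F z) = normsq (1 * F z + 0) by rewrite mul1r addr0.
case: a a' => [u|] [v|] lt.
- move: lt; rewrite /= !E1 => lt.
  by apply: filterS (near_lt (affine 1 (- u)) (affine 1 (- v)) lt) => z;
    rewrite !E1.
- move: lt; rewrite /= E1 => lt.
  by apply: filterS (near_lt (affine 1 (- u)) cst lt) => z; rewrite E1.
- move: lt; rewrite sphere_gap_infinity E0 => lt.
  by apply: filterS (near_lt (affine 1 0) (affine (- v) 1) lt) => z;
    rewrite sphere_gap_infinity -E0.
- by move: lt; rewrite ltxx.
Qed.

Variable s : nat.

(** Voronoi cells: they are disjoint by construction, whence their use. *)
Definition cell (P : 'I_s -> sphere R) (i : 'I_s) : set (sphere R) :=
  [set p | forall j, j != i -> sphere_gap p (P i) < sphere_gap p (P j)].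

Lemma cell_center P i : injective P -> cell P i (P i).
Proof.
move=> PI j ji; rewrite sphere_gap_self sphere_gap_gt0 // => /PI ij.
by rewrite ij eqxx in ji.
Qed.

Lemma cell_disjoint P i j p : cell P i p -> cell P j p -> i = j.
Proof.
move=> Pi Pj; apply/eqP; apply/negP => /negP ij.
have ji : j != i by rewrite eq_sym.
by have := lt_trans (Pj _ ij) (Pi _ ji); rewrite ltxx.
Qed.

End Cells.

(** * Adapted charts *)
Section Submanifold.
Variables (R : realType) (s : nat).
Local Notation C := R[i].
Local Notation n := (s.-1 + s)%N.
Local Notation m := (n + n)%N.
Implicit Types (x : config R s) (y : 'rV[R]_m) (b : 'I_s -> bool) (rho : 'S_m).

Lemma atlas_residue_chart phi : Omega_atlas R s phi ->
  exists b V, residue_chart b 1%g V (realify_chart phi).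
Proof.
move=> [_ [_ [V [[b _ <-] Vb oV Vi ->]]] <-]; exists b, V.
have coordsE x : coords b 1 x = realify (chart_map (config_chart R b) x).
  by apply/rowP => j; rewrite mxE perm1.
have Vc x : V x -> configs x by move=> /Vb[].
split => //.
- suff -> : coords b 1 @` V =
      (fun x => realify (chart_map (config_chart R b) x)) @` V by [].
  by apply/seteqP; split => _ [x Vx <-]; exists x; rewrite ?coordsE.
- apply/seteqP; split => [f [Of [x Vx /= E]]|_ [x Vx <-]].
    have [x' cx' fx'] := Omega_form_of Of.
    exists x => //; rewrite fx'; apply: form_of_class.
    by rewrite E fx' residue_class_form_of.
  split; first exact/form_of_Omega/Vc.
  by exists x => //; rewrite residue_class_form_of //; exact: Vc.
- move=> x Vx; rewrite coordsE /=; congr realify.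
  have -> : V `&` @config_class R s @^-1`
      [set @residue_class R s (form_of x)] = [set x].
    rewrite residue_class_form_of; last exact: Vc.
    apply/seteqP; split => [x' [Vx' /= E]|_ ->] //=.
    by apply: Vi => //; rewrite inE.
  rewrite image_set1; set v := row_mx _ _.
  exact: (xgetPex 0 (ex_intro [set v] v erefl)).
Qed.

Section LocalChart.
Variables (x0 : config R s) (rho : 'S_m).
Hypothesis cx0 : configs x0.

Let b (i : 'I_s) := ~~ isSome (x0.2 i).

(** The poles stay in the cells of those of [x0], so that their numbering can be
    recovered from the form. *)
Definition cell_configs : set (config R s) :=
  [set x | chart_dom (config_chart R b) x /\ forall i, cell x0.2 i (x.2 i)].

Lemma center_cell_configs : cell_configs x0.
Proof.
split; last by move=> i; apply: cell_center; have [] := cx0.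
by split => // i; rewrite /b; case: (x0.2 i).
Qed.

Lemma cell_configs_inj : set_inj cell_configs (@config_class R s).
Proof.
move=> x x' /set_mem[_ cx] /set_mem[_ cx'] /config_class_eqP[sigma E].
have s1 i : sigma i = i.
  apply: (@cell_disjoint _ _ x0.2 _ _ (x.2 (sigma i))); first exact: cx.
  by have := cx' i; rewrite E.
rewrite E [LHS]surjective_pairing.
by congr pair; apply/funext => i /=; rewrite s1.
Qed.

Lemma open_cell_configs : open (coords b rho @` cell_configs).
Proof.
rewrite openE => _ [x [[cx xb] xcell] <-]; set y0 := coords b rho x.
have FF := nbhs_row_filter y0.
have xE : config_of b rho y0 = x by exact/config_ofK.
have near1 : \forall y \near y0, forall i, residue_coord rho y i != 0.
  apply: (@filter_forall _ _ (fun i y => residue_coord rho y i != 0) _ FF) => i.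
  apply: analytic_pair_near0; first exact: analytic_residue_coord.
  by have [x1 _ _] := cx; have := x1 i; rewrite -{1}xE.
have near2 : \forall y \near y0,
    forall i, cell x0.2 i ((config_of b rho y).2 i).
  apply: (@filter_forall _ _
    (fun i y => cell x0.2 i ((config_of b rho y).2 i)) _ FF) => i.
  apply: (@filter_forall _ _ (fun j y => j != i ->
     sphere_gap ((config_of b rho y).2 i) (x0.2 i) <
     sphere_gap ((config_of b rho y).2 i) (x0.2 j)) _ FF) => j.
  have [ji|ji] := boolP (j != i); last by apply: filterE.
  have := xcell i j ji; rewrite -{1 2}xE => lt.
  have := sphere_gap_near (analytic_zcoord rho (rshift s.-1 i) y0) lt.
  by apply: filterS => y ? _.
apply: filterS2 near1 near2 => y r0 cells.
exists (config_of b rho y); last exact: coordsK.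
split => //; split; last by move=> i; exact: sphere_point_dom.
split => //; first exact: residue_coord_sum.
move=> i j ij; apply: (cell_disjoint (cells i)).
by rewrite ij; exact: cells.
Qed.

Definition cell_chart : chart (ratfun R) 'rV[R]_m :=
  Chart (@form_of R s @` cell_configs)
    (fun f => xget 0 [set y | exists2 x, cell_configs x &
       f = form_of x /\ y = coords b rho x]).

Lemma cell_chartE x :
  cell_configs x -> chart_map cell_chart (form_of x) = coords b rho x.
Proof.
move=> Vx /=.
have /(xgetPex 0)[x' Vx' [E ->]] : exists y,
    [set y | exists2 x', cell_configs x' &
       form_of x = form_of x' /\ y = coords b rho x'] y.
  by exists (coords b rho x), x.
congr coords; apply: cell_configs_inj; rewrite ?inE //.
have [[cx _] _] := Vx; have [[cx' _] _] := Vx'.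
by rewrite -!residue_class_form_of // E.
Qed.

Lemma residue_chart_cell_chart : residue_chart b rho cell_configs cell_chart.
Proof.
split => //.
- by move=> x [].
- exact: cell_configs_inj.
- exact: open_cell_configs.
- exact: cell_chartE.
Qed.

Lemma real_analytic_cell_chart :
  real_analytic_chart (Omega R s) (Omega_atlas R s) cell_chart.
Proof.
split.
- by move=> _ [x [[cx _] _] <-]; exact: form_of_Omega.
- move=> f f' /set_mem[x Vx <-] /set_mem[x' Vx' <-].
  rewrite !cell_chartE // => E; congr form_of.
  by rewrite -(config_ofK rho (proj1 Vx)) E config_ofK //; case: Vx'.
- suff -> : chart_map cell_chart @` chart_dom cell_chart =
      coords b rho @` cell_configs.
    exact: open_cell_configs.
  apply/seteqP; split => [_ [_ [x Vx <-] <-]|_ [x Vx <-]].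
    by exists x; rewrite ?cell_chartE.
  by exists (form_of x); [exists x|rewrite cell_chartE].
- move=> phi /atlas_residue_chart[b' [V' phiV']]; split.
    exact: residue_chart_transition phiV' residue_chart_cell_chart.
  exact: residue_chart_transition residue_chart_cell_chart phiV'.
Qed.

End LocalChart.

Lemma RIOmega_form_of x : configs x ->
  RIOmega R s (form_of x) <-> forall i, complex.Re (x.1 i) = 0.
Proof.
move=> cx; split=> [[_ iso] i|re0].
  rewrite -residue_form_of_pole //; apply: iso.
  by rewrite poles_form_of //; exists i.
split; first exact: form_of_Omega.
move=> p; rewrite poles_form_of // => -[i _ <-].
by rewrite residue_form_of_pole.
Qed.

(** The condition on the last residue follows from the others, which is why the
    codimension is [s - 1] and not [s]. *)
Lemma Re_residues0 x : \sum_i x.1 i = 0 ->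
  (forall k, complex.Re (x.1 (widen_ord (leq_pred s) k)) = 0) ->
  forall i, complex.Re (x.1 i) = 0.
Proof.
move=> x0 re0 i; have [il|[k ->]] := ord_lastP i; last exact: re0.
have : complex.Re (\sum_i x.1 i) = 0 by rewrite x0.
rewrite (sum_last_ord _ il); set S := \sum_(_ < _) _.
have S0 : complex.Re S = 0.
  rewrite /S; elim/big_ind: _ => //= z w.
  by case: z w => [z1 z2] [w1 w2] /= -> ->; rewrite addr0.
by case: S S0 (x.1 i) => [S1 S2] /= -> [r1 r2] /=; rewrite add0r.
Qed.

(** In [realify] the real parts of the [s.-1] independent residues come first;
    this cyclic shift makes them the last coordinates. *)
Definition rotation_fun (j : 'I_m) : 'I_m :=
  if insub ((if (j < 3 * s - 1)%N then j + s.-1 else j - (3 * s - 1))%N)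
  is Some k then k else j.

Hypothesis s_gt0 : (0 < s)%N.

Lemma rotation_funE (j : 'I_m) : rotation_fun j =
  (if (j < 3 * s - 1)%N then j + s.-1 else j - (3 * s - 1))%N :> nat.
Proof.
rewrite /rotation_fun insubT; last by move=> ?.
have := ltn_ord j; case: ifP; lia.
Qed.

Lemma rotation_inj : injective rotation_fun.
Proof.
move=> i j /(congr1 val) /=; rewrite !rotation_funE => E; apply: val_inj => /=.
have := ltn_ord i; have := ltn_ord j; move: E; do 2 case: ifP; lia.
Qed.

Definition rotation : 'S_m := perm rotation_inj.

Lemma coords_last b x :
  (forall j : 'I_m, (3 * s - 1 <= j)%N -> coords b rotation x 0 j = 0) <->
  (forall k, complex.Re (x.1 (widen_ord (leq_pred s) k)) = 0).
Proof.
have cE (j : 'I_m) (k : 'I_s.-1) : (j = 3 * s - 1 + k :> nat)%N ->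
    coords b rotation x 0 j = complex.Re (x.1 (widen_ord (leq_pred s) k)).
  move=> jk; rewrite mxE; have -> : rotation j = lshift n (lshift s k).
    apply: val_inj; rewrite /= permE rotation_funE jk; case: ifP; lia.
  by rewrite realify_Re /= row_mxEl mxE.
split=> [H k|H j dj].
  have lt : (3 * s - 1 + k < m)%N by have := ltn_ord k; lia.
  by rewrite -(cE (Ordinal lt)) // H //= leq_addr.
have lt : (j - (3 * s - 1) < s.-1)%N by have := ltn_ord j; lia.
by rewrite (cE _ (Ordinal lt)) ?H //= subnKC.
Qed.

Lemma RIOmega_submanifold :
  real_analytic_submanifold (Omega R s) (Omega_atlas R s) (3 * s - 1)%N
    (RIOmega R s).
Proof.
split; first by lia.
  by move=> f [].
move=> f [Of iso]; have [x0 cx0 fx0] := Omega_form_of Of.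
exists (cell_chart x0 rotation); split.
- exact: real_analytic_cell_chart.
- by exists x0; rewrite ?fx0 //; exact: center_cell_configs.
have inN x : cell_configs x0 x -> RIOmega R s (form_of x) <->
    forall j : 'I_m, (3 * s - 1 <= j)%N ->
      chart_map (cell_chart x0 rotation) (form_of x) 0 j = 0.
  move=> Vx; have [[cx _] _] := Vx; have [_ x_sum _] := cx.
  rewrite RIOmega_form_of // cell_chartE // coords_last.
  by split=> [H k|]; [exact: H|exact: Re_residues0].
apply/seteqP; split=> [_ [_ [[x Vx <-] Nx] <-]|_ [[_ [x Vx <-] <-] zx]].
  split; first by exists (form_of x) => //; exists x.
  exact/inN.
by exists (form_of x) => //; split; [exists x|exact/inN].
Qed.

End Submanifold.

Theorem corollary2p3 (R : realType) (s : nat) (hs : (2 <= s)%N) :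
  real_analytic_submanifold (Omega R s) (Omega_atlas R s) (3 * s - 1)%N
    (RIOmega R s).

Proof. exact: RIOmega_submanifold (ltnW hs). Qed.
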